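(* The following hold for $n$-vertex graphs: \begin{itemize} \item[(a)] $0$-map graphs admit clique-based separators of size $\mathcal{O}(\sqrt{n})$; \item[(b)] unit disk graphs admit clique-based separators of size $\mathcal{O}(\sqrt{n})$; \item[(c)] hyperbolic uniform disk graphs with radius $r$ admit clique-based separators of size $\mathcal{O}\big(\sqrt{\tfrac{r}{\tanh r}}\cdot\sqrt{n}\big)$; \item[(d)] spherical uniform disk graphs with radius $r$ admit clique-based separators of size $\mathcal{O}(\sqrt{n})$. \end{itemize}
   Context: All graphs are finite and simple. A separation of $G$ is a pair $(A,B)$ of subsets of $V(G)$ with $A\cup B=V(G)$ and no edge between $A\setminus B$ and $B\setminus A$; it is $\beta$-balanced if $\max\{|A\setminus B|,|B\setminus A|\}\le\beta|V(G)|$. A clique-based separator of $G$ is a collection $\mathcal{S}$ of pairwise vertex-disjoint cliques whose union is a balanced separator, i.e. equals $A\cap B$ for a $\beta$-balanced separation $(A,B)$, for a fixed absolute constant $\beta<1$; its size is $|\mathcal{S}|$. Implicit constants in $\mathcal{O}(\cdot)$ are absolute (independent of $n$, $r$ and the graph). The intersection graph of a collection of objects has the objects as vertices, two distinct objects adjacent iff they intersect. - $0$-map graph: start with a plane graph $G_0$ with each face labeled a nation or a lake; the vertices are the nations, two distinct ones adjacent iff the corresponding faces share a vertex of $G_0$. - Unit disk graph: intersection graph of closed disks of a common radius in the Euclidean plane. - Hyperbolic uniform disk graph with radius $r>0$: intersection graph of closed disks of the same radius $r$ in the hyperbolic plane of curvature $-1$. - Spherical uniform disk graph with radius $r\in(0,\pi)$: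 intersection graph of spherical disks $\{u\in\mathbb{S}^2: d_{\mathbb{S}^2}(u,v)\le r\}$ of the same radius $r$ on the unit sphere $\mathbb{S}^2\subset\mathbb{R}^3$, with $d_{\mathbb{S}^2}$ the angular distance. *)

(* Defs.v *)
From mathcomp Require Import all_boot all_order all_algebra.
From mathcomp Require Import all_classical all_reals all_analysis.

Set Implicit Arguments.
Unset Strict Implicit.
Unset Printing Implicit Defensive.

Import Order.TTheory GRing.Theory Num.Theory.
Import numFieldNormedType.Exports.

Local Open Scope classical_set_scope.
Local Open Scope ring_scope.

Record sgraph := SGraph {
  vertex :> finType;
  edge : rel vertex;
  edge_sym : symmetric edge;
  edge_irrefl : irreflexive edge }.

Arguments edge {s} x y.

(* No bound such as [0 <= beta] is imposed: a beta-balanced separation of a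
   nonempty graph exists only if [0 <= beta]. *)
Section Separators.
Variables (R : realType) (G : sgraph).
Implicit Types (A B K : {set G}) (S : {set {set G}}).

Definition clique K : Prop :=
  forall x y : G, x \in K -> y \in K -> x != y -> edge x y.

Definition separation A B : Prop :=
  (A :|: B)%SET = [set: G]%SET /\
  forall x y : G, x \in (A :\: B)%SET -> y \in (B :\: A)%SET -> ~~ edge x y.

Definition balanced_separation (beta : R) A B : Prop :=
  separation A B /\
  (maxn #|(A :\: B)%SET| #|(B :\: A)%SET|)%:R <= beta * #|G|%:R.

Definition clique_based_separator (beta : R) S : Prop :=
  [/\ forall K, K \in S -> clique K,
      finset.trivIset S
    & exists A B, balanced_separation beta A B /\ finset.cover S = (A :&: B)%SET].

Definition has_clique_based_separator (beta s : R) : Prop :=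
  exists S, clique_based_separator beta S /\ #|S|%:R <= s.

End Separators.

(* The objects form an indexed family, so the same object may occur several
   times; equal (nonempty) objects give adjacent vertices. *)
Definition is_intersection_graph (G : sgraph) (X : Type) (D : G -> set X) :=
  forall x y : G, edge x y <-> x != y /\ D x `&` D y !=set0.

Section PlaneGraphs.
Variable R : realType.

(* The topology of ['rV[R]_2] is the usual one of the plane; its library norm is
   the sup norm, whence the explicit Euclidean distance further down. *)
Definition is_arc (p q : 'rV[R]_2) (A : set 'rV[R]_2) : Prop :=
  exists f : R -> 'rV[R]_2,
    [/\ {within `[0, 1], continuous f},
        {in `[0, 1] &, injective f},
        f 0 = p, f 1 = q & A = f @` `[0, 1]].

(* [pg_arc x y] is meaningful only when [x] and [y] are adjacent. *)
Record plane_graph := PlaneGraph {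
  pg_graph :> sgraph;
  pg_pt : pg_graph -> 'rV[R]_2;
  pg_arc : pg_graph -> pg_graph -> set 'rV[R]_2;
  pg_pt_inj : injective pg_pt;
  pg_arc_is_arc : forall x y, edge x y -> is_arc (pg_pt x) (pg_pt y) (pg_arc x y);
  pg_arc_sym : forall x y, edge x y -> pg_arc x y = pg_arc y x;
  pg_arc_pt : forall x y z, edge x y -> pg_arc x y (pg_pt z) -> z = x \/ z = y;
  pg_arcs_meet : forall x y x' y', edge x y -> edge x' y' ->
    [set x; y]%SET != [set x'; y']%SET ->
    pg_arc x y `&` pg_arc x' y' `<=` range pg_pt }.

Definition pg_support (P : plane_graph) : set 'rV[R]_2 :=
  range (@pg_pt P) `|`
  [set p | exists x y : P, edge x y /\ pg_arc x y p].

Definition faces (P : plane_graph) : set (set 'rV[R]_2) :=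
  [set F | exists2 p, ~ pg_support P p &
           F = connected_component (~` pg_support P) p].

(* Vertices lie outside the (open) faces, so membership in the closure of a face
   means lying on its boundary. *)
Definition share_vertex (P : plane_graph) (F F' : set 'rV[R]_2) : Prop :=
  exists v : P, closure F (pg_pt v) /\ closure F' (pg_pt v).

(* The faces in [nation] are the nations, the other ones are the lakes. *)
Definition is_0map_graph (G : sgraph) : Prop :=
  exists (P : plane_graph) (nation : set (set 'rV[R]_2)),
    nation `<=` faces P /\
    exists F : G -> set 'rV[R]_2,
      set_bij [set: G] nation F /\
      forall x y : G, edge x y <-> x != y /\ share_vertex P (F x) (F y).

End PlaneGraphs.

Section DiskGraphs.
Variable R : realType.

Definition dotprod n (u v : 'rV[R]_n) : R := \sum_i u 0 i * v 0 i.

Definition euclidean_dist n (u v : 'rV[R]_n) : R :=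
  Num.sqrt (dotprod (u - v) (u - v)).

Definition euclidean_disk (rho : R) (c : 'rV[R]_2) : set 'rV[R]_2 :=
  [set u | euclidean_dist u c <= rho].

Definition is_unit_disk_graph (G : sgraph) : Prop :=
  exists (rho : R) (c : G -> 'rV[R]_2),
    0 < rho /\ is_intersection_graph (fun x => euclidean_disk rho (c x)).

Definition arcosh (x : R) : R := ln (x + Num.sqrt (x ^+ 2 - 1)).

Definition tanh (x : R) : R :=
  (expR x - expR (- x)) / (expR x + expR (- x)).

(* The hyperbolic plane of curvature -1, in the hyperboloid model: the sheet
   [u_2 > 0] of [u_2 ^ 2 - u_0 ^ 2 - u_1 ^ 2 = 1], with
   [cosh (d (u, v)) = u_2 v_2 - u_0 v_0 - u_1 v_1]. *)
Definition lorentz (u v : 'rV[R]_3) : R :=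
  u 0 2%:R * v 0 2%:R - u 0 0 * v 0 0 - u 0 1 * v 0 1.

Definition hyperbolic_plane : set 'rV[R]_3 :=
  [set u | lorentz u u = 1 /\ 0 < u 0 2%:R].

Definition hyperbolic_dist (u v : 'rV[R]_3) : R := arcosh (lorentz u v).

Definition hyperbolic_disk (r : R) (c : 'rV[R]_3) : set 'rV[R]_3 :=
  [set u | hyperbolic_plane u /\ hyperbolic_dist u c <= r].

Definition is_hyperbolic_disk_graph (r : R) (G : sgraph) : Prop :=
  exists c : G -> 'rV[R]_3,
    (forall x, hyperbolic_plane (c x)) /\
    is_intersection_graph (fun x => hyperbolic_disk r (c x)).

Definition sphere2 : set 'rV[R]_3 := [set u | dotprod u u = 1].

Definition spherical_dist (u v : 'rV[R]_3) : R := acos (dotprod u v).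

Definition spherical_disk (r : R) (c : 'rV[R]_3) : set 'rV[R]_3 :=
  [set u | sphere2 u /\ spherical_dist u c <= r].

Definition is_spherical_disk_graph (r : R) (G : sgraph) : Prop :=
  exists c : G -> 'rV[R]_3,
    (forall x, sphere2 (c x)) /\
    is_intersection_graph (fun x => spherical_disk r (c x)).

End DiskGraphs.

(* Main.v *)
(* (a) The incidence graph of nations and vertices of the plane graph has a drawing in
   which independent edges are disjoint: inside a nation, go close to the vertex, then
   straight to the first point of the plane graph, then along an arc to the vertex.
   [K5] has no such drawing. Indeed, cut two disjoint curves into short steps [g_i] and
   [h_j]; the parities of the crossings of a ray by the differences [g_i - h_j] add up to
   zero around the boundary of the grid, and the sum of these identities over the 15 pairs
   of independent edges reads [0 = 1]. So the incidence graph has no [K5] minor, and the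
   argument of Alon, Seymour and Thomas applies: either all branch sets of a partial model
   of [K5] are attached to the heavy flap close to one vertex, which extends the model by a
   small branch set, or few nations cut the heavy flap off from one of the branch sets.
   A vertex of the plane graph in the separator stands for the clique of the nations
   around it.

   (b)-(d) Stereographic projection turns hyperbolic disks, and the spherical disks that
   avoid the pole, into Euclidean disks; the spherical disks containing the pole form one
   clique. For Euclidean disks of arbitrary radii, let [s] be the least diameter of a set
   of at least [n / 26] centers, and consider about [sqrt n] concentric squares of
   half-side between [s] and [2 s]. All of them are balanced. One of them is crossed by
   [O(sqrt n)] disks of radius at most [s / sqrt n], and the larger disks crossing it are
   pierced by [O(sqrt n)] points. *)
Require Import Defs.
From mathcomp Require Import all_boot all_order all_algebra.
From mathcomp Require Import zify lra ring.
From mathcomp Require Import boolp reals.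

Set Implicit Arguments.
Unset Strict Implicit.
Unset Printing Implicit Defensive.

Import Order.TTheory GRing.Theory Num.Theory.

(** * Separators of K5-minor-free bipartite graphs *)

Section ConnectedSets.
Variables (T : finType) (e : rel T).
Hypothesis e_sym : symmetric e.
Implicit Types (A B P S U X : {set T}).

Definition induced_rel S : rel T := fun x y => [&& x \in S, y \in S & e x y].

Definition cnset S := forall x y, x \in S -> y \in S -> connect (induced_rel S) x y.

Lemma induced_sym S : connect_sym (induced_rel S).
Proof.
apply: sym_connect_sym => x y; rewrite /induced_rel e_sym; by case: (x \in S); case: (y \in S).
Qed.

Lemma connect_inducedS A B x y :
  A \subset B -> connect (induced_rel A) x y -> connect (induced_rel B) x y.
Proof.
move=> sAB; apply: connect_sub => u v /and3P[uA vA uv]; apply: connect1.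
by rewrite /induced_rel (subsetP sAB) // (subsetP sAB).
Qed.

Lemma cnset1 x : cnset [set x].
Proof. by move=> u v /set1P-> /set1P->; apply: connect0. Qed.

Lemma cnset_closed S P x : cnset S -> x \in S -> x \in P ->
  (forall y z, y \in S -> z \in S -> y \in P -> e y z -> z \in P) -> S \subset P.
Proof.
move=> cS xS xP clP; apply/subsetP => y yS.
have /connectP[p pp ->] := cS x y xS yS.
elim: p x xS xP pp => [|z p IHp] x xS xP //= /andP[/and3P[_ zS xz] pp].
exact: (IHp z zS (clP _ _ xS zS xP xz) pp).
Qed.

Lemma cnset_star S x : x \in S ->
  (forall y, y \in S -> connect (induced_rel S) x y) -> cnset S.
Proof.
move=> xS Sx y z yS zS; apply: connect_trans (Sx z zS).
by rewrite induced_sym; apply: Sx.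
Qed.

Lemma cnsetU A B x : cnset A -> cnset B -> x \in A -> x \in B -> cnset (A :|: B).
Proof.
move=> cA cB xA xB; apply: (@cnset_star _ x); first by rewrite inE xA.
move=> y /setUP[yA|yB].
- by apply: connect_inducedS (cA x y xA yA); apply: subsetUl.
- by apply: connect_inducedS (cB x y xB yB); apply: subsetUr.
Qed.

Lemma cnset_edge x y : e x y -> cnset [set x; y].
Proof.
move=> xy; apply: (@cnset_star _ x); first by rewrite !inE eqxx.
move=> z /set2P[->|->]; first exact: connect0.
by apply: connect1; rewrite /induced_rel !inE !eqxx orbT.
Qed.

Lemma cnsetU_edge A B x y : cnset A -> cnset B -> x \in A -> y \in B -> e x y ->
  cnset (A :|: B).
Proof.
move=> cA cB xA yB xy.
have -> : A :|: B = (A :|: [set x; y]) :|: B.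
  apply/setP => z; rewrite !inE; case: eqP => [->|_]; first by rewrite xA.
  by case: eqP => [->|_]; rewrite ?yB ?orbT ?orbF.
apply: (@cnsetU _ _ y) => //; last by rewrite !inE eqxx !orbT.
by apply: (@cnsetU _ _ x) => //; [apply: cnset_edge | rewrite !inE eqxx].
Qed.

Definition comp S x : {set T} := [set y in S | connect (induced_rel S) x y].

Lemma comp_sub S x : comp S x \subset S.
Proof. by apply/subsetP => y; rewrite inE => /andP[]. Qed.

Lemma comp_id S x : x \in S -> x \in comp S x.
Proof. by move=> xS; rewrite inE xS connect0. Qed.

Lemma comp_closed S x y z : y \in comp S x -> z \in S -> e y z -> z \in comp S x.
Proof.
rewrite !inE => /andP[yS xy] zS yz; rewrite zS /=; apply: connect_trans xy _.
by apply: connect1; rewrite /induced_rel yS zS.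
Qed.

Lemma cnset_comp S x : x \in S -> cnset (comp S x).
Proof.
move=> xS; apply: (@cnset_star _ x); first exact: comp_id.
move=> y; rewrite inE => /andP[yS /connectP[p pp ->]].
elim/last_ind: p pp => [|p z IHp] //=.
rewrite rcons_path last_rcons => /andP[pp /and3P[lS zS lz]].
have lC : last x p \in comp S x by rewrite inE lS; apply/connectP; exists p.
apply: connect_trans (IHp pp) _; apply: connect1; rewrite /induced_rel lC lz andbT /=.
exact: comp_closed lz.
Qed.

Lemma cnset_sub_comp A S x : cnset A -> A \subset S -> x \in A -> A \subset comp S x.
Proof.
move=> cA sAS xA; apply/subsetP => y yA; rewrite inE (subsetP sAS) //=.
exact: connect_inducedS (cA x y xA yA).
Qed.

(** For [U] disjoint from [X], this makes [U] a union of components of the graph without [X]. *)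
Definition cut_off X U := forall u v, u \in U -> v \notin U -> e u v -> v \in X.

Lemma comp_cut_off S x : cut_off (~: S) (comp S x).
Proof.
move=> u v uC vC uv; rewrite inE; apply: contra vC => vS; exact: comp_closed uv.
Qed.

Definition minor_model k (B : 'I_k -> {set T}) :=
  [/\ forall i, cnset (B i),
      forall i, exists x, x \in B i,
      forall i j, i != j -> [disjoint B i & B j]
    & forall i j, i != j -> exists x y, [/\ x \in B i, y \in B j & e x y]].

Lemma minor_model_inj k l (f : 'I_l -> 'I_k) (B : 'I_k -> {set T}) : injective f ->
  minor_model B -> minor_model (fun j => B (f j)).
Proof.
move=> fI [Bc B0 Bd Ba]; split=> // i j ij; [apply: Bd | apply: Ba];
  by rewrite (inj_eq fI).
Qed.

Definition ord_snoc (C : Type) k (f : 'I_k -> C) (c : C) (j : 'I_k.+1) : C :=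
  if unlift ord_max j is Some i then f i else c.

Lemma ord_snoc_max (C : Type) k (f : 'I_k -> C) c : ord_snoc f c ord_max = c.
Proof. by rewrite /ord_snoc unlift_none. Qed.

Lemma ord_snoc_lift (C : Type) k (f : 'I_k -> C) c i :
  ord_snoc f c (lift ord_max i) = f i.
Proof. by rewrite /ord_snoc liftK. Qed.

Lemma minor_model_snoc k (B : 'I_k -> {set T}) (A : {set T}) a :
  minor_model B -> cnset A -> a \in A -> (forall i, [disjoint B i & A]) ->
  (forall i, exists x y, [/\ x \in B i, y \in A & e x y]) ->
  minor_model (ord_snoc B A).
Proof.
move=> [Bc B0 Bd Ba] cA aA dA adA; split.
- by move=> i; case: (unliftP ord_max i) => [j|] ->; rewrite ?ord_snoc_lift ?ord_snoc_max.
- move=> i; case: (unliftP ord_max i) => [j|] ->; rewrite ?ord_snoc_lift ?ord_snoc_max //.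
  by exists a.
- move=> i j; case: (unliftP ord_max i) => [i'|] ->; case: (unliftP ord_max j) => [j'|] ->;
    rewrite ?ord_snoc_lift ?ord_snoc_max // ?eqxx //.
  + by rewrite (inj_eq (@lift_inj _ _)); apply: Bd.
  + by move=> _; rewrite disjoint_sym.
- move=> i j; case: (unliftP ord_max i) => [i'|] ->; case: (unliftP ord_max j) => [j'|] ->;
    rewrite ?ord_snoc_lift ?ord_snoc_max // ?eqxx //.
  + by rewrite (inj_eq (@lift_inj _ _)); apply: Ba.
  + by move=> _; have [x [y [xB yA xy]]] := adA j'; exists y, x; rewrite e_sym.
Qed.

Lemma minor_model_grow k (B : 'I_k -> {set T}) i (W : {set T}) :
  minor_model B -> cnset W -> B i \subset W ->
  (forall j, j != i -> [disjoint B j & W]) ->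
  minor_model (fun j => if j == i then W else B j).
Proof.
move=> [Bc B0 Bd Ba] cW sBW dW; split.
- by move=> j; case: eqP.
- by move=> j; case: eqP => _ //; have [x xB] := B0 i; exists x; exact: (subsetP sBW).
- move=> j l jl; case: eqP => [ji|/eqP ji]; case: eqP => [li|/eqP li].
  + by rewrite ji li eqxx in jl.
  + by rewrite disjoint_sym; apply: dW.
  + exact: dW.
  + exact: Bd.
- move=> j l jl; have [x [y [xB yB xy]]] := Ba _ _ jl; exists x, y; split=> //.
  + by case: eqP => // ji; rewrite ji in xB; apply: (subsetP sBW).
  + by case: eqP => // li; rewrite li in yB; apply: (subsetP sBW).
Qed.

End ConnectedSets.

(** * Balls and layers in a bipartite graph *)

Section Balls.
Variables (T : finType) (e : rel T) (N U : {set T}).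
Hypothesis e_sym : symmetric e.
Hypothesis e_bip : forall x y, e x y -> (x \in N) = (y \notin N).
Implicit Types (A B S X : {set T}).

Definition grow (M B : {set T}) : {set T} :=
  B :|: [set u in U :&: M | [exists b in B, e b u]].

(* The balls grow by two steps at a time, so that only elements of [N] have to be removed
   to disconnect a ball from its complement. *)
Fixpoint reach A t : {set T} :=
  if t is t'.+1 then grow (~: N) (grow N (reach A t')) else grow (~: N) A.

Definition layer A t : {set T} := grow N (reach A t) :\: reach A t.

Lemma grow_ext M B : B \subset grow M B.
Proof. exact: subsetUl. Qed.

Lemma sub_ball A t : A \subset reach A t.
Proof.
elim: t => [|t IHt] /=; first exact: grow_ext.
exact: subset_trans IHt (subset_trans (grow_ext _ _) (grow_ext _ _)).
Qed.

Lemma ball_subset A s t : s <= t -> reach A s \subset reach A t.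
Proof.
elim: t => [|t IHt]; first by rewrite leqn0 => /eqP->.
rewrite leq_eqVlt => /predU1P[-> //|]; rewrite ltnS => /IHt sst.
exact: subset_trans sst (subset_trans (grow_ext _ _) (grow_ext _ _)).
Qed.

Lemma layer_sub A t : layer A t \subset U :&: N.
Proof.
apply/subsetP => x; rewrite !inE => /andP[/negPf->] /=.
by case/andP.
Qed.

(** The last growth step of a ball goes to the complement of [N]. If [z] is outside [N], then [y] is
    in [N] and was present before that step, which therefore added [z]. So balls are left only
    through [N]. *)
Lemma ball_exit A t y z :
  y \in reach A t -> z \in U -> e y z -> z \notin reach A t -> z \in layer A t.
Proof.
move=> yB zU yz zB; rewrite inE zB /=.
have gz (M B : {set T}) : y \in B -> z \in M -> z \in grow M B.
  move=> yB' zM; rewrite !inE zU zM /=; apply/orP; right.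
  by apply/existsP; exists y; rewrite yB' yz.
case zN : (z \in N); first exact: gz.
have yN : y \in N by rewrite (e_bip yz) zN.
case/negP: zB; move: yB.
have ug B : y \in grow (~: N) B -> y \in B.
  by rewrite !inE yN /= andbF orbF.
by case: t => [|t] /= /ug yB; apply: gz yB _; rewrite inE zN.
Qed.

Lemma sum_layers A r : \sum_(t < r) #|layer A t| <= #|N|.
Proof.
suff h : \sum_(t < r) #|layer A t| + #|reach A 0 :&: N| <= #|reach A r :&: N|.
  apply: leq_trans (leq_trans (leq_addr _ _) h) _.
  by apply: subset_leq_card; apply: subsetIr.
elim: r => [|r IHr]; first by rewrite big_ord0.
rewrite big_ord_recr /= addnAC.
apply: leq_trans (leq_add IHr (leqnn _)) _.
have I0 : (reach A r :&: N) :&: layer A r = set0.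
  by apply/setP => x; rewrite !inE; case: (x \in reach A r); rewrite /= ?andbF.
rewrite -cardsUI I0 cards0 addn0; apply: subset_leq_card; apply/subsetP => x.
rewrite in_setU !in_setI => /orP[/andP[xB ->]|xL].
  by rewrite andbT (subsetP (ball_subset A (leqnSn r))).
have := subsetP (layer_sub A r) x xL; rewrite inE => /andP[_ ->]; rewrite andbT.
by apply: (subsetP (grow_ext _ _)); move: xL; rewrite inE => /andP[].
Qed.

Lemma small_layer A r : 0 < r -> #|N| <= r * r ->
  exists2 t, t < r & #|layer A t| <= r.
Proof.
move=> r0 nr; case: (pickP (fun t : 'I_r => #|layer A t| <= r)) => [t tr|all_big].
  by exists t.
have : \sum_(t < r) r.+1 <= \sum_(t < r) #|layer A t|.
  by apply: leq_sum => t _; rewrite ltnNge all_big.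
rewrite sum_nat_const card_ord => /leq_trans /(_ (sum_layers A r)).
by move=> /leq_trans /(_ nr); rewrite mulnS; lia.
Qed.

(** [S] follows a path back to [A]: the ball of index [t] arises from [A] by [2 t + 1] growth steps,
    each costing one element on top of the starting one. *)
Lemma ball_reach A t x : A \subset U -> x \in reach A t ->
  exists S, [/\ S \subset U, cnset e S, x \in S, (exists a, (a \in S) && (a \in A))
    & #|S| <= (t.+1).*2].
Proof.
move=> AU.
pose P k (B : {set T}) := forall x, x \in B -> exists S, [/\ S \subset U, cnset e S, x \in S,
  (exists a, (a \in S) && (a \in A)) & #|S| <= k].
have Pg M k B : P k B -> P k.+1 (grow M B).
  move=> PB y; rewrite in_setU => /orP[/PB[S [SU Sc Sy Sa Sk]]|].
    by exists S; split=> //; apply: leqW.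
  rewrite inE in_setI => /andP[/andP[yU _] /existsP[b /andP[/PB[S [SU Sc Sb [a /andP[aS aA]] Sk]] by_]]].
  exists (S :|: [set y]); split.
  - by rewrite subUset SU sub1set.
  - by apply: (cnsetU_edge e_sym Sc (@cnset1 _ _ y) Sb _ by_); rewrite inE.
  - by rewrite !inE eqxx orbT.
  - by exists a; rewrite inE aS.
  - by rewrite (leq_trans (leq_card_setU _ _)) // cards1 addn1.
have PA : P 1 A.
  move=> y yA; exists [set y]; split; rewrite ?sub1set ?(subsetP AU) ?inE ?cards1 //.
  - exact: cnset1.
  - by exists y; rewrite inE eqxx.
suff : P (t.+1).*2 (reach A t) by apply.
elim: t {x} => [|t IHt]; first by apply: Pg.
by rewrite doubleS; apply: (Pg); apply: Pg.
Qed.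

End Balls.

(** * Descent on partial models of K5 *)

Section MinorSeparator.
Variables (T : finType) (e : rel T) (N : {set T}).
Hypothesis e_sym : symmetric e.
Hypothesis e_bip : forall x y, e x y -> (x \in N) = (y \notin N).
Implicit Types (A B S U X Y : {set T}).

Definition heavy U := #|N| < (#|U :&: N|).*2.

(** A nonempty flap is a component of the graph without [X]; the empty set also qualifies, but it is
    never heavy. *)
Definition flap X U := [/\ cnset e U, [disjoint U & X] & cut_off e X U].

Lemma heavy_meet U U' : heavy U -> heavy U' -> exists2 x, x \in U & x \in U'.
Proof.
rewrite /heavy => hU hU'.
case: (pickP (fun x => (x \in U) && (x \in U'))) => [x /andP[xU xU']|UU'].
  by exists x.
have := cardsUI (U :&: N) (U' :&: N).
have -> : (U :&: N) :&: (U' :&: N) = set0.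
  by apply/setP => x; rewrite !inE andbACA [X in X && _]UU'.
have : #|(U :&: N) :|: (U' :&: N)| <= #|N|.
  by apply: subset_leq_card; rewrite subUset !subsetIr.
rewrite cards0; lia.
Qed.

(** Two heavy flaps always meet, so this makes the heavy flap shrink as more elements are deleted.
    An edge leaving [U] ends in [X], which the connected set [U'] avoids. *)
Lemma flap_sub X X' U U' x : cut_off e X U -> flap X' U' -> X \subset X' ->
  x \in U -> x \in U' -> U' \subset U.
Proof.
move=> cU [cU' dU' _] sX xU xU'; apply: (cnset_closed cU' xU' xU) => y z _ zU' yU yz.
apply: contraT => zU; have zX := subsetP sX _ (cU _ _ yU zU yz).
by rewrite (disjointFr dU' zU') in zX.
Qed.

Variable r : nat.
Hypotheses (r_gt0 : 0 < r) (N_le : #|N| <= r * r).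
Hypothesis no_K5 : ~ exists B : 'I_5 -> {set T}, minor_model e B.
Hypothesis heavy_flap : forall X, #|X| <= 85 * r -> exists U, flap X U /\ heavy U.

(* The branch sets [B i] may be large, but only the small parts [X i] are needed to
   separate the heavy flap [U] from the rest. *)
Definition covey k (B X : 'I_k -> {set T}) U :=
  [/\ minor_model e B,
      forall i, X i \subset B i,
      forall i, #|X i| <= 17 * r,
      forall i, [disjoint B i & U]
    & [/\ cnset e U, heavy U & cut_off e (\bigcup_i X i) U]].

Lemma card_bigcup_ord k (X : 'I_k -> {set T}) m :
  (forall i, #|X i| <= m) -> #|\bigcup_i X i| <= k * m.
Proof.
move=> Xm; apply: (@leq_trans (\sum_(i < k) m)); last by rewrite sum_nat_const card_ord.
elim/big_ind2: _ => [|A a B b Aa Bb|i _] //; first by rewrite cards0.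
by apply: leq_trans (leq_card_setU _ _) (leq_add Aa Bb).
Qed.

Definition attach (B : {set T}) U := [set u in U | [exists b in B, e b u]].

Lemma attach_sub B U : attach B U \subset U.
Proof. by apply/subsetP => x; rewrite inE => /andP[]. Qed.

(** No edge leaving [U] ends in [X i] when no element of [U] is adjacent to [B i], so the other
    small parts still cut [U] off. *)
Lemma covey_drop k (B X : 'I_k.+1 -> {set T}) U i :
  covey B X U -> attach (B i) U = set0 ->
  covey (fun j => B (lift i j)) (fun j => X (lift i j)) U.
Proof.
move=> [mB XB Xc BU [cU hU kU]] A0; split=> //.
  exact: minor_model_inj (@lift_inj _ i) mB.
split=> // u v uU vU uv; have /bigcupP[j _ vX] := kU u v uU vU uv.
have [j' jE|jE] := unliftP i j; first by apply/bigcupP; exists j'; rewrite -?jE.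
have : u \in attach (B i) U.
  rewrite inE uU /=; apply/existsP; exists v; rewrite e_sym uv andbT.
  by rewrite (subsetP (XB i)) // -jE.
by rewrite A0 inE.
Qed.

(** Short connected sets from [x] to all attachments form a further branch set [S'], adjacent to
    every old one. With four old ones this is a model of K5; otherwise [S'] serves as its own small
    part, and the next heavy flap loses [x]. *)
Lemma covey_extend k (B X : 'I_k -> {set T}) U x : k <= 4 -> covey B X U ->
  x \in U -> (forall i, x \in reach e N U (attach (B i) U) r) ->
  k < 4 /\ exists (B' X' : 'I_k.+1 -> {set T}) U', covey B' X' U' /\ #|U'| < #|U|.
Proof.
move=> k4 [mB XB Xc BU [cU hU kU]] xU xb.
have [S SP] := fin_all_exists (fun i => ball_reach e_sym (attach_sub (B i) U) (xb i)).
pose S' := x |: \bigcup_i S i.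
have xS' : x \in S' by rewrite !inE eqxx.
have SS' i : S i \subset S' by rewrite /S' subsetU // (bigcup_sup i) ?orbT.
have S'U : S' \subset U.
  rewrite subUset sub1set xU; apply/bigcupsP => i _; by case: (SP i).
have cS' : cnset e S'.
  apply: (cnset_star e_sym xS') => y; rewrite in_setU1 => /predU1P[->|/bigcupP[i _ yS]].
    exact: connect0.
  have [_ cSi xSi _ _] := SP i; apply: connect_inducedS (SS' i) _; exact: cSi.
(* At most [1 + 4 * 2 * (r + 1) = 8 * r + 9], which is below [17 * r] or equal to it because
   [0 < r]. *)
have S'c : #|S'| <= 17 * r.
  have : #|S'| <= 1 + k * (r.+1).*2.
    apply: leq_trans (leq_card_setU _ _) _; rewrite cards1 leq_add2l.
    by apply: card_bigcup_ord => i; case: (SP i).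
  by move: k4 r_gt0; clear; nia.
have mB' : minor_model e (ord_snoc B S').
  apply: (minor_model_snoc e_sym mB cS' xS') => i.
    exact: disjointWr S'U (BU i).
  have [_ _ _ [a /andP[aS aA]] _] := SP i.
  have := aA; rewrite inE => /andP[_ /existsP[b /andP[bB ba]]].
  by exists b, a; split=> //; apply: (subsetP (SS' i)).
have k_lt4 : k < 4.
  rewrite ltn_neqAle k4 andbT; apply/eqP => kE; apply: no_K5.
  suff H l (C : 'I_l -> {set T}) : l = 5 -> minor_model e C ->
    exists C' : 'I_5 -> {set T}, minor_model e C'.
    by apply: H mB'; rewrite kE.
  by move=> l5; case: _ / (esym l5) C => C mC; exists C.
split=> //; pose X' := ord_snoc X S'.
have X'c i : #|X' i| <= 17 * r.
  by rewrite /X'; case: (unliftP ord_max i) => [j|] ->;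
    rewrite ?ord_snoc_lift ?ord_snoc_max.
have [U' [fU' hU']] : exists U', flap (\bigcup_i X' i) U' /\ heavy U'.
  apply: heavy_flap; apply: leq_trans (card_bigcup_ord X'c) _.
  by move: k_lt4; clear; nia.
have [z zU zU'] := heavy_meet hU hU'.
have XX' : \bigcup_i X i \subset \bigcup_i X' i.
  apply/bigcupsP => i _; apply: (bigcup_max (lift ord_max i)) => //.
  by rewrite /X' ord_snoc_lift.
have sU'U := flap_sub kU fU' XX' zU zU'.
have [cU' dU' kU'] := fU'.
have S'U' : [disjoint S' & U'].
  rewrite disjoint_sym; apply: disjointWr dU'.
  by apply: (bigcup_max ord_max) => //; rewrite /X' ord_snoc_max.
exists (ord_snoc B S'), X', U'; split.
  split=> // i; rewrite /X'; case: (unliftP ord_max i) => [j|] ->;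
    rewrite ?ord_snoc_lift ?ord_snoc_max //.
  exact: disjointWr sU'U (BU j).
apply: proper_card; apply/properP; split=> //; exists x => //.
by rewrite (disjointFr S'U' xS').
Qed.

(** The flap [U2] avoids all attachments of [B i], so [B i] can absorb its component [W] in
    [B i :|: (U :\: U2)]. The frontier of [W] towards the heavy flap lies in [Y], so the small part
    stays small however large [W] gets. *)
Lemma covey_push k (B X : 'I_k -> {set T}) U i Y U2 : k <= 4 -> covey B X U ->
  #|Y| <= 4 * r -> Y \subset U -> attach (B i) U != set0 ->
  flap (\bigcup_i X i :|: Y) U2 -> heavy U2 -> [disjoint U2 & attach (B i) U] ->
  exists (B' X' : 'I_k -> {set T}) U', covey B' X' U' /\ #|U'| < #|U|.
Proof.
move=> k4 [mB XB Xc BU [cU hU kU]] Yc YU A0 fU2 hU2 dA.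
have [Bc B0 Bd Ba] := mB.
have [b0 b0B] := B0 i.
pose V := B i :|: (U :\: U2); pose W := comp e V b0.
have BW : B i \subset W by apply: cnset_sub_comp; rewrite ?subsetUl.
have b0V : b0 \in V by rewrite inE b0B.
have cW : cnset e W by apply: cnset_comp.
have WU x : x \in W -> x \in U -> x \in U :\: U2.
  move=> /(subsetP (comp_sub _ _ _)); rewrite inE => /orP[xB xU|//].
  by rewrite (disjointFr (BU i) xB) in xU.
have AW : attach (B i) U \subset W.
  apply/subsetP => a aA; have := aA; rewrite inE => /andP[aU /existsP[b /andP[bB ba]]].
  apply: (@comp_closed _ _ V b0 b) ba; first exact: (subsetP BW).
  by rewrite !inE aU (disjointFl dA aA) orbT.
have AU := attach_sub (B i) U.
pose B' j := if j == i then W else B j.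
pose X' j := if j == i then Y :&: W else X j.
have X'c j : #|X' j| <= 17 * r.
  rewrite /X'; case: eqP => // _.
  apply: leq_trans (subset_leq_card (subsetIl _ _)) (leq_trans Yc _).
  by rewrite leq_mul2r orbT.
have [U3 [fU3 hU3]] : exists U', flap (\bigcup_i X' i) U' /\ heavy U'.
  apply: heavy_flap; apply: leq_trans (card_bigcup_ord X'c) _.
  by move: k4; clear; nia.
have [cU3 dU3 kU3] := fU3; have [cU2 dU2 kU2] := fU2.
have sU2U : U2 \subset U.
  have [z zU zU2] := heavy_meet hU hU2.
  by apply: flap_sub kU fU2 _ zU zU2; apply: subsetUl.
(* [U3] meets [U2], outside [W]. To leave [U] through [X i] it would pass an attachment of [B i],
   which lies in [W]. To enter [W] from [U2] it would use [Y :&: W], which is deleted, and an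
   element of [U :\: U2] adjacent to [W] already belongs to [W]. *)
have sU3 : U3 \subset U :\: W.
  have [z zU2 zU3] := heavy_meet hU2 hU3.
  have zW : z \in U :\: W.
    have zU := subsetP sU2U _ zU2; rewrite inE zU andbT.
    by apply/negP => /WU/(_ zU); rewrite inE zU2.
  apply: (cnset_closed cU3 zU3 zW) => y w _ wU3; rewrite inE => /andP[yW yU] yw.
  have wX' j : w \notin X' j.
    apply/negP => wX; have : w \in \bigcup_i X' i by apply/bigcupP; exists j.
    by rewrite (disjointFr dU3 wU3).
  have wU : w \in U.
    apply: contraT => wU; have /bigcupP[j _ wX] := kU y w yU wU yw.
    have [ji|ji] := eqVneq j i; last first.
      by have := wX' j; rewrite /X' (negPf ji) wX.
    case/negP: yW; apply: (subsetP AW); rewrite inE yU; apply/existsP; exists w.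
    by rewrite e_sym yw andbT (subsetP (XB i)) // -ji.
  rewrite inE wU andbT; apply/negP => wW.
  have := WU w wW wU; rewrite inE wU andbT => wU2.
  case yU2 : (y \in U2).
    have := kU2 y w yU2 wU2 yw; rewrite inE => /orP[/bigcupP[j _ wX]|wY].
      by rewrite (disjointFr (BU j) (subsetP (XB j) _ wX)) in wU.
    by have := wX' i; rewrite /X' eqxx inE wY wW.
  case/negP: yW; apply: (@comp_closed _ _ V b0 w) => //; last by rewrite e_sym.
  by rewrite !inE yU yU2 orbT.
have sU3U : U3 \subset U by apply: subset_trans sU3 (subsetDl _ _).
exists B', X', U3; split.
  split=> //.
  - apply: minor_model_grow => // j ji; rewrite disjoints_subset.
    apply/subsetP => x xB; rewrite inE; apply/negP => /(subsetP (comp_sub _ _ _)).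
    rewrite inE => /orP[xBi|]; first by rewrite (disjointFr (Bd _ _ ji) xB) in xBi.
    by rewrite inE (disjointFr (BU j) xB) andbF.
  - by move=> j; rewrite /X' /B'; case: eqP => // _; apply: subsetIr.
  - move=> j; rewrite /B'; case: eqP => _; last exact: disjointWr sU3U (BU j).
    rewrite disjoint_sym disjoints_subset; apply: subset_trans sU3 _.
    by apply/subsetP => x; rewrite !inE => /andP[].
have /set0Pn[a aA] := A0.
apply: proper_card; apply/properP; split=> //; exists a.
  exact: (subsetP AU).
apply/negP => /(subsetP sU3); rewrite inE => /andP[/negP aW _].
exact/aW/(subsetP AW).
Qed.

(** Either drop a branch set without attachments, or extend the model at an element close to all
    attachments, or push a branch set whose attachments the new heavy flap misses. The weight 5 on
    the flap outweighs one additional branch set. *)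
Lemma covey_step k (B X : 'I_k -> {set T}) U : k <= 4 -> covey B X U ->
  exists k' (B' X' : 'I_k' -> {set T}) U',
    [/\ k' <= 4, covey B' X' U' & 5 * #|U'| + k' < 5 * #|U| + k].
Proof.
move=> k4 cv; case: (pickP (fun i => attach (B i) U == set0)) => [i /eqP A0|A0].
  case: k B X cv i A0 k4 => [|k] B X cv i A0 k4; first by case: i A0.
  exists k, (fun j => B (lift i j)), (fun j => X (lift i j)), U.
  by split; [lia | exact: covey_drop A0 | lia].
case: (pickP (fun x => (x \in U) && [forall i, x \in reach e N U (attach (B i) U) r])) => [x|xb].
  move=> /andP[xU /forallP xb].
  have [k_lt4 [B' [X' [U' [cv' UU']]]]] := covey_extend k4 cv xU xb.
  by exists k.+1, B', X', U'; split=> //; lia.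
have [mB XB Xc BU [cU hU kU]] := cv.
have [t tP] : exists t : 'I_k -> nat, forall i,
    t i < r /\ #|layer e N U (attach (B i) U) (t i)| <= r.
  apply: (fin_all_exists (P := fun i t => t < r /\ #|layer e N U (attach (B i) U) t| <= r)) => i.
  by have [t tr tc] := small_layer e U (attach (B i) U) r_gt0 N_le; exists t.
pose Y := \bigcup_i layer e N U (attach (B i) U) (t i).
have Yc : #|Y| <= 4 * r.
  apply: leq_trans (card_bigcup_ord (fun i => (tP i).2)) _.
  by rewrite leq_mul2r k4 orbT.
have YU : Y \subset U.
  apply/bigcupsP => i _; apply: subset_trans (layer_sub _ _ _ _ _) (subsetIl _ _).
have [U2 [fU2 hU2]] : exists U', flap (\bigcup_i X i :|: Y) U' /\ heavy U'.
  apply: heavy_flap; apply: leq_trans (leq_card_setU _ _) _.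
  by move: (card_bigcup_ord Xc) Yc k4; clear; nia.
have [z zU zU2] := heavy_meet hU hU2.
have sU2U : U2 \subset U by apply: flap_sub kU fU2 _ zU zU2; apply: subsetUl.
case: (pickP (fun i => [disjoint U2 & attach (B i) U])) => [i dA|dA].
  have [B' [X' [U' [cv' UU']]]] :=
    covey_push k4 cv Yc YU (negbT (A0 i)) fU2 hU2 dA.
  by exists k, B', X', U'; split=> //; lia.
(* Now [U2] meets all attachments. It is connected and avoids the layers in [Y], so it cannot leave
   any of the balls; this would put [z] close to all attachments, against [xb]. *)
have := xb z; rewrite zU => /negbT /forallPn[i /negP]; case.
have /negbT := dA i; rewrite -setI_eq0 => /set0Pn[a]; rewrite inE => /andP[aU2 aA].
have [cU2 dU2 _] := fU2.
apply: (subsetP (ball_subset e N U _ (ltnW (tP i).1))).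
apply: (subsetP (cnset_closed cU2 aU2 _ _) z zU2); first exact: (subsetP (sub_ball _ _ _ _ _)).
move=> y w yU2 wU2 yb yw; apply: contraT => wb.
have wY : w \in Y.
  by apply/bigcupP; exists i => //; apply: ball_exit yb _ yw wb => //; apply: (subsetP sU2U).
by have := disjointFr dU2 wU2; rewrite inE wY orbT.
Qed.

Lemma covey_absurd k (B X : 'I_k -> {set T}) U : k <= 4 -> ~ covey B X U.
Proof.
have [m] := ubnP (5 * #|U| + k); elim: m k B X U => // m IHm k B X U lem k4 cv.
have [k' [B' [X' [U' [k'4 cv' lt]]]]] := covey_step k4 cv.
by apply: IHm cv' => //; lia.
Qed.

End MinorSeparator.

Theorem K5_minor_free_separator (T : finType) (e : rel T) (N : {set T}) r :
  symmetric e -> (forall x y, e x y -> (x \in N) = (y \notin N)) ->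
  0 < r -> #|N| <= r * r -> ~ (exists B : 'I_5 -> {set T}, minor_model e B) ->
  exists2 X : {set T}, #|X| <= 85 * r & forall U, flap e X U -> ~~ heavy N U.
Proof.
move=> e_sym e_bip r0 Nr nK5.
apply: contrapT => nX.
have hf (X : {set T}) : #|X| <= 85 * r -> exists U, flap e X U /\ heavy N U.
  move=> Xc; apply: contrapT => nU; apply: nX; exists X => // U fU.
  by apply/negP => hU; apply: nU; exists U.
have [|U [[cU _ kU] hU]] := hf set0; first by rewrite cards0.
pose B0 : 'I_0 -> {set T} := fun=> set0.
apply: (@covey_absurd T e N e_sym e_bip r r0 Nr nK5 hf 0 B0 B0 U) => //.
split; try by [case]; try by split; case.
by split=> // u v uU vU uv; have := kU u v uU vU uv; rewrite inE.
Qed.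

(** * From separators of the incidence graph to clique-based separators *)

Local Open Scope ring_scope.

Lemma exists_nat_sqrt (R : realType) (n : nat) : (0 < n)%N ->
  exists r : nat, [/\ (0 < r)%N, (n <= r * r)%N & r%:R <= 2 * Num.sqrt n%:R :> R].
Proof.
move=> n0; have exr : exists r, (n <= r * r)%N by exists n; rewrite leq_pmulr.
case: (ex_minnP exr) => r nr rmin; exists r.
have r0 : (0 < r)%N by case: r nr {rmin} => //; lia.
split=> //.
have r1 : (r.-1 * r.-1 < n)%N.
  by rewrite ltnNge; apply/negP => /rmin; lia.
have s1 : 1 <= Num.sqrt n%:R :> R by rewrite -[leLHS]sqrtr1 ler_sqrt // ler1n.
have : r.-1%:R <= Num.sqrt n%:R :> R.
  rewrite -[leLHS]ger0_norm // -sqrtr_sqr ler_sqrt // expr2 -natrM ler_nat.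
  exact: ltnW.
have -> : r%:R = r.-1%:R + 1 :> R by rewrite natr1 prednK.
lra.
Qed.

(** The cliques are the fibers of [code] on [X], disjoint by construction; the separation is
    [L :|: X] and [~: L :|: X]. *)
Lemma clique_separatorI (R : realType) (G : sgraph) (beta s : R) (X L : {set G})
    (K : finType) (code : G -> K) :
  (forall x y, x \in X -> y \in X -> x != y -> code x = code y -> edge x y) ->
  (forall x y, x \notin X -> y \notin X -> x \in L -> y \notin L -> ~~ edge x y) ->
  #|L :\: X|%:R <= beta * #|G|%:R -> #|~: (L :|: X)|%:R <= beta * #|G|%:R ->
  #|code @: X|%:R <= s ->
  has_clique_based_separator G beta s.
Proof.
move=> codeX LX cL cR cs.
pose fiber k := [set x in X | code x == k].
exists [set fiber k | k in code @: X]; split; last first.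
  by apply: le_trans cs; rewrite ler_nat leq_imset_card.
split.
- move=> _ /imsetP[k _ ->] x y; rewrite !inE => /andP[xX /eqP xk] /andP[yX /eqP yk] xy.
  by apply: codeX; rewrite ?xk.
- apply/trivIsetP => _ _ /imsetP[k _ ->] /imsetP[l _ ->] kl.
  rewrite -setI_eq0; apply/eqP/setP => x; rewrite !inE.
  apply/negP => /andP[/andP[_ /eqP xk] /andP[_ /eqP xl]].
  by rewrite -xk -xl eqxx in kl.
have AB : (L :|: X) :\: (~: L :|: X) = L :\: X.
  by apply/setP => x; rewrite !inE; case: (x \in L); case: (x \in X).
have BA : (~: L :|: X) :\: (L :|: X) = ~: (L :|: X).
  by apply/setP => x; rewrite !inE; case: (x \in L); case: (x \in X).
exists (L :|: X), (~: L :|: X); split.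
  split; first split.
  - by apply/setP => x; rewrite !inE; case: (x \in L); rewrite ?orbT.
  - rewrite AB BA => x y; rewrite !inE => /andP[xX xL]; rewrite negb_or => /andP[yL yX].
    exact: LX.
  - by rewrite AB BA natr_max; rewrite ge_max cL cR.
apply/setP => x; transitivity (x \in X); last first.
  by rewrite !inE; case: (x \in L); case: (x \in X).
apply/bigcupP/idP => [[_ /imsetP[k _ ->]]|xX]; first by rewrite inE => /andP[].
by exists (fiber (code x)); rewrite ?inE ?xX ?eqxx //; apply/imset_f/imset_f.
Qed.

Lemma empty_graph_separator (R : realType) (G : sgraph) (beta C : R) :
  #|G| = 0%N -> has_clique_based_separator G beta (C * Num.sqrt #|G|%:R).
Proof.
move=> G0; apply: (@clique_separatorI _ _ _ _ set0 set0 unit (fun=> tt)).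
- by move=> x; rewrite inE.
- by move=> x y _ _; rewrite inE.
- by rewrite setD0 cards0 G0 mulr0.
- by rewrite (_ : #|_| = 0%N) ?G0 ?mulr0 //; apply/eqP; rewrite -leqn0 -G0 max_card.
- by rewrite imset0 cards0 G0 sqrtr0 mulr0.
Qed.

Definition incidence (I V : finType) (inc : I -> V -> bool) : rel (I + V) :=
  fun u w => match u, w with
    | inl x, inr v | inr v, inl x => inc x v
    | _, _ => false
    end.

Lemma incidence_sym (I V : finType) (inc : I -> V -> bool) :
  symmetric (incidence inc).
Proof. by case=> x [y|y]. Qed.

Lemma incidence_clique_separator (R : realType) (G : sgraph) (V : finType)
    (inc : G -> V -> bool) :
  (forall x y : G, edge x y <-> x != y /\ exists v, inc x v && inc y v) ->
  ~ (exists B : 'I_5 -> {set G + V}, minor_model (incidence inc) B) ->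
  has_clique_based_separator G (3 / 4 : R) (170 * Num.sqrt #|G|%:R).
Proof.
move=> edgeE nK5; have e_sym := incidence_sym inc.
have [G0|G0] := posnP #|G|; first exact: empty_graph_separator.
have [r [r0 nr rn]] := exists_nat_sqrt R G0.
pose N : {set G + V} := inl @: [set: G].
have inlN x : (inl x : G + V) \in N by rewrite imset_f ?inE.
have inrN v : (inr v : G + V) \notin N by apply/negP => /imsetP[].
have e_bip u w : incidence inc u w -> (u \in N) = (w \notin N).
  by case: u w => [x|x] [y|y] //= _; rewrite inlN (negPf (inrN _)).
have cN : #|N| = #|G| by rewrite card_imset ?cardsT // => ? ? [].
have [|X Xc Xfl] := K5_minor_free_separator e_sym e_bip r0 _ nK5; first by rewrite cN.
(* One side will be a smallest union of components outside [X] that holds at least a quarter of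
   [N :\: X]. *)
pose closedX (B : {set G + V}) :=
  [forall u in B, forall w, (w \notin X) ==> incidence inc u w ==> (w \in B)].
pose big (B : {set G + V}) :=
  [&& closedX B, B \subset ~: X & (#|N :\: X| <= 4 * #|B :&: N|)%N].
have bigT : big (~: X).
  apply/and3P; split=> //; last first.
    by rewrite setIC -setDE; lia.
  by apply/forall_inP => u _; apply/forallP => w; rewrite inE; case: (w \in X); rewrite ?implybT.
case: (arg_minnP (fun B : {set G + V} => #|B|) bigT) => B /and3P[clB BX Bm] Bmin.
have clBP u w : u \in B -> w \notin X -> incidence inc u w -> w \in B.
  by move=> uB wX uw; have /forall_inP/(_ u uB)/forallP/(_ w) := clB; rewrite wX uw.
have NXc : (#|N :\: X| <= #|G|)%N by rewrite -cN subset_leq_card // subsetDl.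
(* By minimality, removing a component [Q] from [B] leaves less than a quarter; [Q] is not heavy, so
   [B] holds at most [1 / 4 + 1 / 2] of all vertices. *)
have Bc : (4 * #|B :&: N| <= 3 * #|G|)%N.
  have [->|/set0Pn[u uB]] := eqVneq B set0; first by rewrite set0I cards0.
  pose Q := comp (incidence inc) (~: X) u.
  have uX : u \in ~: X by apply: (subsetP BX).
  have fQ : flap (incidence inc) X Q.
    split; first exact: cnset_comp.
      by rewrite disjoints_subset comp_sub.
    by move=> v w vQ wQ vw; have := comp_cut_off vQ wQ vw; rewrite !inE negbK.
  have := Xfl Q fQ; rewrite /heavy cN -leqNgt => Qc.
  have BQ : ~~ big (B :\: Q).
    apply/negP => /Bmin; rewrite leqNgt => /negP; apply; apply: proper_card.
    apply/properP; split; first exact: subsetDl.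
    by exists u => //; rewrite inE comp_id.
  have : (4 * #|(B :\: Q) :&: N| < #|N :\: X|)%N.
    rewrite ltnNge; apply: contra BQ => BQc; apply/and3P; split=> //; last first.
      by apply: subset_trans BX; apply: subsetDl.
    apply/forall_inP => v; rewrite inE => /andP[vQ vB]; apply/forallP => w.
    apply/implyP => wX; apply/implyP => vw; rewrite inE (clBP v) // andbT.
    apply: contra vQ => wQ; apply: comp_closed wQ _ _; last by rewrite e_sym.
    exact: (subsetP BX).
  have : (#|B :&: N| <= #|(B :\: Q) :&: N| + #|Q :&: N|)%N.
    apply: leq_trans (leq_card_setU _ _); apply: subset_leq_card.
    by apply/subsetP => w; rewrite in_setU !in_setI in_setD => /andP[-> ->]; case: (w \in Q).
  lia.
have Rc : (4 * #|N :\: X :\: B| <= 3 * #|G|)%N.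
  have : (#|N :\: X :\: B| + #|B :&: N| = #|N :\: X|)%N.
    rewrite -(cardsID B (N :\: X)) addnC; congr (_ + _)%N; apply: eq_card => w.
    rewrite !inE; case wB : (w \in B) => /=; rewrite ?andbF //.
    by have := subsetP BX w wB; rewrite inE => ->; rewrite andbT.
  lia.
pose Sep := [set x | (inl x \in X) || [exists v, (inr v \in X) && inc x v]].
pose L := [set x : G | inl x \in B].
(* All codes of [Sep] lie in [X]: a vertex incident to some [v] in [X] joins the clique around such
   a [v], and the others are singletons. *)
pose code x : G + V :=
  if [pick v | (inr v \in X) && inc x v] is Some v then inr v else inl x.
have injl : injective (@inl G V) by move=> ? ? [].
apply: (@clique_separatorI _ _ _ _ Sep L _ code).
- move=> x y _ _ xy; rewrite /code; case: pickP => [v /andP[_ xv]|_];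
    case: pickP => [w /andP[_ yw]|_] //.
    by case=> vw; apply/edgeE; split=> //; exists v; rewrite xv vw.
  by case=> xy'; rewrite xy' eqxx in xy.
- move=> x y; rewrite !inE !negb_or => /andP[xX xV] /andP[yX yV] xB yB.
  apply/negP => /edgeE[_ [v /andP[xv yv]]]; case/negP: yB.
  have vX : inr v \notin X.
    by apply: contra xV => vX; apply/existsP; exists v; rewrite vX.
  by apply: (clBP (inr v)) => //; apply: (clBP (inl x)).
- apply: (@le_trans _ _ (#|B :&: N|%:R)).
    rewrite ler_nat -(card_imset _ injl); apply: subset_leq_card.
    by apply/subsetP => _ /imsetP[x + ->]; rewrite !inE inlN andbT => /andP[].
  have : (4 * #|B :&: N|)%:R <= (3 * #|G|)%:R :> R by rewrite ler_nat.
  rewrite !natrM; lra.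
- apply: (@le_trans _ _ (#|N :\: X :\: B|%:R)).
    rewrite ler_nat -(card_imset _ injl); apply: subset_leq_card.
    apply/subsetP => _ /imsetP[x + ->]; rewrite !inE inlN andbT !negb_or.
    by case/and3P=> -> ->.
  have : (4 * #|N :\: X :\: B|)%:R <= (3 * #|G|)%:R :> R by rewrite ler_nat.
  rewrite !natrM; lra.
- apply: (@le_trans _ _ (#|X|%:R)).
    rewrite ler_nat; apply: subset_leq_card.
    apply/subsetP => _ /imsetP[x + ->]; rewrite inE /code.
    case: pickP => [v /andP[]//|nov] /orP[//|/existsP[v]].
    by rewrite nov.
  apply: (@le_trans _ _ (85 * r)%:R); first by rewrite ler_nat.
  rewrite natrM; lra.
Qed.

(** * Nonplanarity of K5 by parity *)

From mathcomp Require Import all_classical all_reals all_analysis.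
Import numFieldNormedType.Exports.

(* Each [K a b c] occurs in two of the 15 identities, whereas the terms in [o] add up to
   the number of crossings of [K5] drawn on a convex pentagon, which is 5. *)
Lemma K5_parity (K : 'I_5 -> 'I_5 -> 'I_5 -> bool) (o : 'I_5 -> 'I_5 -> bool) :
  (forall a b, a != b -> o a b = ~~ o b a) ->
  (forall a b c d, uniq [:: a; b; c; d] ->
     K a b c (+) K a b d (+) K c d a (+) K c d b =
     o a c (+) o a d (+) o b c (+) o b d) -> False.
Proof.
move=> oN KE.
pose p0 := @Ordinal 5 0 isT; pose p1 := @Ordinal 5 1 isT; pose p2 := @Ordinal 5 2 isT.
pose p3 := @Ordinal 5 3 isT; pose p4 := @Ordinal 5 4 isT.
(* Equal parities become an even sum of naturals, so that linear arithmetic can add up the 15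
   identities. *)
have ev (a b c d e f g h : bool) : a (+) b (+) c (+) d = e (+) f (+) g (+) h ->
    exists k : nat, (a + b + c + d + e + f + g + h = k * 2)%N.
  move=> E; exists ((a + b + c + d + e + f + g + h)./2).
  by move: E; case: a; case: b; case: c; case: d; case: e; case: f; case: g; case: h.
have oE (a b : 'I_5) : a != b -> (o a b + o b a = 1)%N.
  by move=> /oN ->; case: (o b a).
have [k1 E1] := ev _ _ _ _ _ _ _ _ (KE p0 p1 p2 p3 isT).
have [k2 E2] := ev _ _ _ _ _ _ _ _ (KE p0 p2 p1 p3 isT).
have [k3 E3] := ev _ _ _ _ _ _ _ _ (KE p0 p3 p1 p2 isT).
have [k4 E4] := ev _ _ _ _ _ _ _ _ (KE p0 p1 p2 p4 isT).
have [k5 E5] := ev _ _ _ _ _ _ _ _ (KE p0 p2 p1 p4 isT).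
have [k6 E6] := ev _ _ _ _ _ _ _ _ (KE p0 p4 p1 p2 isT).
have [k7 E7] := ev _ _ _ _ _ _ _ _ (KE p0 p1 p3 p4 isT).
have [k8 E8] := ev _ _ _ _ _ _ _ _ (KE p0 p3 p1 p4 isT).
have [k9 E9] := ev _ _ _ _ _ _ _ _ (KE p0 p4 p1 p3 isT).
have [k10 E10] := ev _ _ _ _ _ _ _ _ (KE p0 p2 p3 p4 isT).
have [k11 E11] := ev _ _ _ _ _ _ _ _ (KE p0 p3 p2 p4 isT).
have [k12 E12] := ev _ _ _ _ _ _ _ _ (KE p0 p4 p2 p3 isT).
have [k13 E13] := ev _ _ _ _ _ _ _ _ (KE p1 p2 p3 p4 isT).
have [k14 E14] := ev _ _ _ _ _ _ _ _ (KE p1 p3 p2 p4 isT).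
have [k15 E15] := ev _ _ _ _ _ _ _ _ (KE p1 p4 p2 p3 isT).
have := oE p2 p1 isT; have := oE p3 p1 isT; have := oE p3 p2 isT.
have := oE p4 p1 isT; have := oE p4 p2 isT; have := oE p4 p3 isT.
move: E1 E2 E3 E4 E5 E6 E7 E8 E9 E10 E11 E12 E13 E14 E15; clear.
repeat match goal with |- context [nat_of_bool ?b] => move: (nat_of_bool b) => ? end.
lia.
Qed.

Section PlaneParity.
Variable R : realType.
Implicit Types (u v a b c d : 'rV[R]_2) (eta : R).

Lemma norm_coord u i : `|u 0 i| <= `|u|.
Proof.
rewrite -[leRHS]/(mx_norm u) mx_normrE.
exact: (le_bigmax _ (fun ij => `|u ij.1 ij.2|) (0, i)).
Qed.

Lemma norm_coordP u : `|u| = `|u 0 0| \/ `|u| = `|u 0 1|.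
Proof.
rewrite -[X in X = _]/(mx_norm u) -[X in _ \/ X = _]/(mx_norm u).
have [u0|/mx_norm_neq0[[i j] ->]] := eqVneq (mx_norm u) 0.
  by left; rewrite (mx_norm_eq0 u0) mxE normr0 mx_norm0.
rewrite /= ord1; case: j => [[|[|//]]] lt2; [left|right];
  by congr (`|u _ _|); apply/val_inj.
Qed.

(* Lexicographic positivity, which breaks ties on the horizontal axis. *)
Definition upper u := (0 < u 0 1) || ((u 0 1 == 0) && (0 < u 0 0)).

Lemma upperN u : u != 0 -> upper (- u) = ~~ upper u.
Proof.
move=> u0; rewrite /upper !mxE !oppr_gt0 oppr_eq0.
case: (ltgtP (u 0 1) 0) => //= y0; case: (ltgtP (u 0 0) 0) => //= x0.
case/negP: u0; apply/eqP/rowP => i; rewrite mxE.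
by case: i => [[|[|]]] //= i; [rewrite -x0|rewrite -y0]; congr (u _ _); apply/val_inj.
Qed.

(* Crossing of the positive horizontal axis by a step from [u] to [v]; this is meaningful
   only if the step is short compared with the norm of [u]. *)
Definition ray_cross u v := (upper u != upper v) && (0 < u 0 0).

Lemma far_coord eta u : 0 < eta -> 4 * eta <= `|u| -> `|u 0 1| < 2 * eta -> 4 * eta <= `|u 0 0|.
Proof.
by move=> eta0; case: (norm_coordP u) => -> //; lra.
Qed.

Lemma upper_near eta u v : 0 < eta -> 2 * eta <= `|u 0 1| -> `|v - u| < 2 * eta ->
  upper v = (0 < u 0 1).
Proof.
move=> eta0 uy uv; have := le_lt_trans (norm_coord (v - u) 1) uv.
rewrite !mxE ltr_norml => /andP[vu1 vu2]; rewrite /upper.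
move: uy; case: (ltP 0 (u 0 1)) => y0.
  by rewrite (ger0_norm (ltW y0)) => uy; apply/orP; left; lra.
rewrite ler0_norm // => uy; apply/negbTE; rewrite negb_or -leNgt negb_and.
by apply/andP; split; [|apply/orP; left; rewrite lt_eqF]; lra.
Qed.

Lemma abscissa_near eta u v : 0 < eta -> 4 * eta <= `|u 0 0| -> `|v - u| < 2 * eta ->
  (0 < v 0 0) = (0 < u 0 0).
Proof.
move=> eta0 ux uv; have := le_lt_trans (norm_coord (v - u) 0) uv.
rewrite !mxE ltr_norml => /andP[vu1 vu2].
move: ux; case: (ltP 0 (u 0 0)) => x0.
  by rewrite (ger0_norm (ltW x0)) => ux; lra.
by rewrite ler0_norm // => ux; apply/negbTE; rewrite -leNgt; lra.
Qed.

(** If [u1] is far from the horizontal axis, [upper] is constant on the corners. Otherwise [u1] is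
    far from the vertical axis, all abscissas have the same sign, and the changes of [upper] around
    the cell cancel. *)
Lemma ray_cross_cell eta u1 u2 u3 u4 : 0 < eta -> 4 * eta <= `|u1| ->
  `|u2 - u1| < 2 * eta -> `|u3 - u1| < 2 * eta -> `|u4 - u1| < 2 * eta ->
  ray_cross u1 u2 (+) ray_cross u2 u3 (+) ray_cross u4 u3 (+) ray_cross u1 u4 = false.
Proof.
move=> eta0 u1f u12 u13 u14; have u11 : `|u1 - u1| < 2 * eta by rewrite subrr normr0; lra.
have [u1y|u1y] := leP (2 * eta) `|u1 0 1|.
  by rewrite /ray_cross !(upper_near eta0 u1y u11, upper_near eta0 u1y u12,
    upper_near eta0 u1y u13, upper_near eta0 u1y u14) eqxx.
have u1x := far_coord eta0 u1f u1y.
rewrite /ray_cross !(abscissa_near eta0 u1x u12, abscissa_near eta0 u1x u13,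
    abscissa_near eta0 u1x u14).
by case: (0 < u1 0 0); case: (upper u1); case: (upper u2); case: (upper u3); case: (upper u4).
Qed.

(** Negation turns crossings of the negative half-axis into crossings of the positive one, and both
    kinds together are the changes of [upper]. *)
Lemma ray_crossN eta u v : 0 < eta -> 4 * eta <= `|u| -> `|v - u| < eta ->
  ray_cross (- u) (- v) = ray_cross u v (+) upper u (+) upper v.
Proof.
move=> eta0 uf uv.
have uv2 : `|v - u| < 2 * eta by lra.
have u0 : u != 0 by apply: contraTneq uf => ->; rewrite normr0 -ltNge; lra.
have v0 : v != 0.
  apply: contraTneq uv => ->; rewrite sub0r normrN -leNgt; lra.
rewrite /ray_cross !upperN // !mxE oppr_gt0.
have [uy|uy] := leP (2 * eta) `|u 0 1|.
  have uu : `|u - u| < 2 * eta by rewrite subrr normr0; lra.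
  by rewrite (upper_near eta0 uy uu) (upper_near eta0 uy uv2) !eqxx addbb.
have ux := far_coord eta0 uf uy.
have : u 0 0 != 0 by rewrite -normr_gt0; lra.
by case: (ltgtP (u 0 0) 0) => //= _ _; case: (upper u); case: (upper v).
Qed.

Definition step eta : rel 'rV[R]_2 := fun u v => `|v - u| < eta.

Fixpoint crossings c a (s : seq 'rV[R]_2) : bool :=
  if s is b :: s' then ray_cross (a - c) (b - c) (+) crossings c b s' else false.

Lemma crossings_strip eta c d a s : 0 < eta -> step eta c d -> path (step eta) a s ->
  (forall u, u \in a :: s -> 4 * eta <= `|u - c|) ->
  crossings c a s (+) crossings d a s =
  ray_cross (a - c) (a - d) (+) ray_cross (last a s - c) (last a s - d).
Proof.
move=> eta0 cd; elim: s a => [|b s IHs] a /=; first by rewrite addbb.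
case/andP=> ab ps far; rewrite addbACA IHs //; last first.
  by move=> u us; apply: far; rewrite inE us orbT.
have /(_ a (mem_head _ _)) := far; move: ab cd; rewrite /step => ab cd ac.
have := @ray_cross_cell eta (a - c) (b - c) (b - d) (a - d) eta0 ac.
rewrite (_ : b - c - (a - c) = b - a); last by rewrite opprB addrA subrK.
rewrite (_ : b - d - (a - c) = (b - a) - (d - c)); last first.
  by rewrite !opprB [c - a]addrC -!addrA; congr (b + _); rewrite addrC -!addrA; congr (- a + _); rewrite addrC.
rewrite (_ : a - d - (a - c) = - (d - c)); last first.
  by rewrite !opprB addrC addrA subrK.
have bacd : `|b - a - (d - c)| < 2 * eta.
  by apply: le_lt_trans (ler_normB _ _) _; lra.
rewrite normrN; have [ab2 cd2] : `|b - a| < 2 * eta /\ `|d - c| < 2 * eta by lra.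
move=> /(_ ab2 bacd cd2).
by do 4!case: (ray_cross _ _); case: (ray_cross _ _).
Qed.

(* The crossing parity of the closed walk around each cell of the grid [a_i - c_j] is
   even; summing over the grid leaves the four sides. *)
Lemma crossings_grid eta c t a s : 0 < eta ->
  path (step eta) a s -> path (step eta) c t ->
  (forall u v, u \in a :: s -> v \in c :: t -> 4 * eta <= `|u - v|) ->
  crossings c a s (+) crossings (last c t) a s (+)
    crossings a c t (+) crossings (last a s) c t =
  upper (c - a) (+) upper (last c t - a) (+)
    upper (c - last a s) (+) upper (last c t - last a s).
Proof.
move=> eta0 ps; elim: t c => [|d t IHt] c /=.
  by case: (crossings _ _ _); case: (upper (c - a)); case: (upper _).
case/andP=> cd pt far.
have {}IHt := IHt d pt _; have far' u v : u \in a :: s -> v \in d :: t -> 4 * eta <= `|u - v|.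
  by move=> us vt; apply: far; rewrite // inE vt orbT.
have {IHt}E1 := IHt far'.
have farc u : u \in a :: s -> 4 * eta <= `|u - c|.
  by move=> us; apply: far; rewrite ?mem_head.
have E2 := crossings_strip eta0 cd ps farc.
have rev u : u \in a :: s -> ray_cross (u - c) (u - d) =
    ray_cross (c - u) (d - u) (+) upper (c - u) (+) upper (d - u).
  move=> us; rewrite -(opprB c u) -(opprB d u); apply: (ray_crossN eta0).
    by rewrite distrC; apply: farc.
  by rewrite opprB addrA subrK.
move: E2; rewrite rev ?mem_head // rev ?mem_last // => E2.
move: E1 E2.
set x1 := crossings c a s; set x2 := crossings d a s; set x3 := crossings (last d t) a s.
set y1 := crossings a d t; set y2 := crossings (last a s) d t.
set z1 := ray_cross (c - a) (d - a); set z2 := ray_cross (c - last a s) (d - last a s).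
set o1 := upper (c - a); set o2 := upper (d - a).
set o3 := upper (c - last a s); set o4 := upper (d - last a s).
set o5 := upper (last d t - a); set o6 := upper (last d t - last a s).
move=> E1 E2.
have -> : x1 = z1 (+) o1 (+) o2 (+) (z2 (+) o3 (+) o4) (+) x2 by rewrite -E2 addbK.
have -> : x3 = x2 (+) (o2 (+) o5 (+) o4 (+) o6) (+) y1 (+) y2.
  by rewrite -E1; case: (x2); case: (x3); case: (y1); case: (y2).
clear; case: x2; case: y1; case: y2; case: z1; case: z2; case: o2; case: o4;
by case: o1; case: o3; case: o5; case: o6.
Qed.

End PlaneParity.

(** * Chains of short steps and drawings of K5 *)

Section Chains.
Variable R : realType.
Implicit Types (A B : set 'rV[R]_2) (a b c d : 'rV[R]_2) (eta : R).

(* Connected sets are chained, and this weaker notion is all that the parity argument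
   needs; it composes without reparametrizing any path. *)
Definition chained A a b := forall eta, 0 < eta ->
  exists s, [/\ path (step eta) a s, last a s = b & forall u, u \in a :: s -> A u].

Lemma chained_sub A B a b : (forall u, A u -> B u) -> chained A a b -> chained B a b.
Proof.
move=> AB Aab eta /Aab[s [ps ls As]]; exists s; split=> // u /As; exact: AB.
Qed.

Lemma chained_refl A a : A a -> chained A a a.
Proof. by move=> Aa eta _; exists [::]; split=> // u; rewrite inE => /eqP->. Qed.

Lemma chained_trans A a b c : chained A a b -> chained A b c -> chained A a c.
Proof.
move=> ab bc eta eta0; have [s [ps ls As]] := ab _ eta0; have [t [pt lt At]] := bc _ eta0.
exists (s ++ t); rewrite cat_path last_cat ls; split=> //; first by rewrite ps.
move=> u; rewrite inE mem_cat => /or3P[/eqP->|us|ut].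
- by apply: As; rewrite mem_head.
- by apply: As; rewrite inE us orbT.
- by apply: At; rewrite inE ut orbT.
Qed.

Lemma chained_sym A a b : chained A a b -> chained A b a.
Proof.
move=> ab eta eta0; have [s [ps <- As]] := ab _ eta0.
exists (rev (belast a s)); split.
- by rewrite rev_path; apply: sub_path ps => u v; rewrite /step distrC.
- by case: s {ps As} => //= b' s; rewrite rev_cons last_rcons.
- move=> u; rewrite -rev_rcons mem_rev -lastI; exact: As.
Qed.

Lemma no_K5_drawing (p : 'I_5 -> 'rV[R]_2) (E : 'I_5 -> 'I_5 -> set 'rV[R]_2) eta :
  0 < eta -> (forall i j, i != j -> chained (E i j) (p i) (p j)) ->
  (forall i j k l, uniq [:: i; j; k; l] -> forall u v, E i j u -> E k l v ->
    eta <= `|u - v|) -> False.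
Proof.
(* A quarter, because points on independent edges have to be at least four steps apart. *)
move=> eta0 Ech Edist; pose del := eta / 4.
have del0 : 0 < del by rewrite divr_gt0.
have [s sP] : exists s : 'I_5 * 'I_5 -> seq 'rV[R]_2, forall ij, ij.1 != ij.2 ->
    [/\ path (step del) (p ij.1) (s ij), last (p ij.1) (s ij) = p ij.2
      & forall u, u \in p ij.1 :: s ij -> E ij.1 ij.2 u].
  apply: (fin_all_exists (P := fun ij t => ij.1 != ij.2 -> [/\ path (step del) (p ij.1) t,
    last (p ij.1) t = p ij.2 & forall u, u \in p ij.1 :: t -> E ij.1 ij.2 u])).
  move=> [i j] /=; have [_|ij] := eqVneq i j; first by exists [::].
  by have [t tP] := Ech i j ij del del0; exists t.
apply: (@K5_parity (fun i j k => crossings (p k) (p i) (s (i, j)))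
  (fun i j => upper (p j - p i))).
  move=> i j ij; rewrite -upperN ?opprB //; rewrite subr_eq0.
  (* The positions of [i] and [j] differ because two independent edges start there. *)
  have [k [l [ik jl uikjl]]] : exists k l : 'I_5, [/\ i != k, j != l & uniq [:: i; k; j; l]].
    have : (1 < #|~: [set i; j]|)%N by have := cardsC [set i; j]; rewrite cards2 ij card_ord; lia.
    case/card_gt1P => k [l []]; rewrite !inE !negb_or => /andP[ki kj] /andP[li lj] kl.
    by exists k, l; rewrite /= !inE !negb_or ij kj kl !(eq_sym _ k) !(eq_sym _ l) ki li lj.
  have [_ _ /(_ _ (mem_head _ _)) Ei] := sP (i, k) ik.
  have [_ _ /(_ _ (mem_head _ _)) Ej] := sP (j, l) jl.
  apply: contraTneq (Edist _ _ _ _ uikjl _ _ Ei Ej) => /= ->.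
  by rewrite subrr normr0 -ltNge.
move=> i j k l uijkl /=.
have /and3P[ij kl _] : [&& i != j, k != l & true].
  by move: uijkl; rewrite /= !inE !negb_or => /and4P[/and3P[-> _ _] _ ->].
have [pij lij Eij] := sP (i, j) ij; have [pkl lkl Ekl] := sP (k, l) kl.
have far u v : u \in p i :: s (i, j) -> v \in p k :: s (k, l) -> 4 * del <= `|u - v|.
  move=> /Eij Eu /Ekl Ev; rewrite /del mulrC divfK ?pnatr_eq0 //.
  exact: Edist Eu Ev.
have := crossings_grid del0 pij pkl far.
by rewrite lij lkl /= => ->; rewrite -!addbA; congr addb; rewrite addbCA addbA addbC addbA.
Qed.

End Chains.

(** * Drawings of graphs with a K5 minor *)

Section DrawnMinors.
Variables (R : realType) (T : finType) (e : rel T).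
Hypothesis e_sym : symmetric e.
Variables (pos : T -> 'rV[R]_2) (E : T -> T -> set 'rV[R]_2) (eta : R).
Hypothesis E_chained : forall x y, e x y -> chained (E x y) (pos x) (pos y).
Hypothesis eta_gt0 : 0 < eta.
Hypothesis E_far : forall x y x' y', e x y -> e x' y' ->
  [disjoint [set x; y]%SET & [set x'; y']%SET] ->
  forall u v, E x y u -> E x' y' v -> eta <= `|u - v|.

(** The drawing of the subgraph induced by [S]; an edge of K5 is routed through the drawing of the
    union of its two branch sets. *)
Let M (S : {set T}) : set 'rV[R]_2 := fun q =>
  exists x y, [/\ x \in S, y \in S, e x y & E x y q].

Lemma no_drawn_K5_minor : ~ exists B : 'I_5 -> {set T}, minor_model e B.
Proof.
case=> B [Bc B0 Bd Ba].
have [b bB] := fin_all_exists B0.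
apply: (@no_K5_drawing R (fun i => pos (b i)) (fun i j => M (B i :|: B j)) eta) => //.
- move=> i j ij; have [x [y [xB yB xy]]] := Ba _ _ ij.
  have cB := cnsetU_edge e_sym (Bc i) (Bc j) xB yB xy.
  (* [M] consists of points of edges, so the path between the base points needs at least one
     edge. *)
  have bij : b i != b j.
    by apply: contraTneq (bB i) => ->; rewrite (disjointFl (Bd _ _ ij)).
  have /connectP[s ps lE] : connect (induced_rel e (B i :|: B j)) (b i) (b j).
    by apply: cB; rewrite inE bB ?orbT.
  move: bij; rewrite lE; move: (b i) ps => z {lE}.
  elim: s z => [|w s IHs] z /=; first by rewrite eqxx.
  case/andP=> /and3P[zS wS zw] ps _.
  have zw_ch : chained (M (B i :|: B j)) (pos z) (pos w).
    by apply: chained_sub (E_chained zw) => q Eq; exists z, w.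
  have [<-//|ne] := eqVneq w (last w s).
  exact: chained_trans zw_ch (IHs _ ps ne).
- move=> i j k l uijkl u v [x [y [xS yS xy Eu]]] [x' [y' [xS' yS' xy' Ev]]].
  apply: (E_far xy xy') Eu Ev.
  have dis z : z \in B i :|: B j -> z \notin B k :|: B l.
    move: uijkl; rewrite /= !inE !negb_or => /and4P[/and3P[_ ik il] /andP[jk jl] _ _].
    by case/orP=> zB; rewrite !(disjointFr (Bd _ _ _) zB).
  rewrite -setI_eq0; apply/eqP/setP => z; rewrite !inE.
  apply/negP => /andP[/orP[]/eqP-> /orP[]/eqP zE];
    by [have := dis _ xS; rewrite zE ?xS' ?yS' | have := dis _ yS; rewrite zE ?xS' ?yS'].
Qed.

End DrawnMinors.

(** * Map graphs *)

Local Open Scope classical_set_scope.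

Lemma finite_min_pos (R : realType) (I : finType) (P : I -> R -> Prop) :
  (forall i d d', 0 < d' -> d' <= d -> P i d -> P i d') ->
  (forall i, exists2 d, 0 < d & P i d) -> exists2 d, 0 < d & forall i, P i d.
Proof.
move=> Pmon Pex.
suff [d d0 dP] : exists2 d, 0 < d & forall i, i \in enum I -> P i d.
  by exists d => // i; apply: dP; rewrite mem_enum.
elim: (enum I) => [|i s [d d0 dP]]; first by exists 1.
have [d' d'0 Pd'] := Pex i.
exists (Num.min d d'); first by rewrite lt_min d0.
move=> j; rewrite inE => /predU1P[->|js].
  by apply: Pmon Pd'; rewrite ?lt_min ?d0 // ge_min lexx orbT.
by apply: Pmon (dP j js); rewrite ?lt_min ?d0 // ge_min lexx.
Qed.

Ltac vector_ring := apply/rowP => ?; rewrite !mxE; ring.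

(** * Distances, segments and connectedness in the plane *)

Section PlaneTopology.
Variable R : realType.
Implicit Types (A B F K : set 'rV[R]_2) (a b c p q v : 'rV[R]_2) (eta : R).

Lemma nbhs_dist p A : nbhs p A <-> exists2 d : R, 0 < d & forall q, `|q - p| < d -> A q.
Proof.
split=> [/(nbhs_normP p A)[d /= d0 dA]|[d d0 dA]].
  by exists d => // q qd; apply: dA; rewrite /= distrC.
by apply/(nbhs_normP p A); exists d => // q /=; rewrite distrC; apply: dA.
Qed.

Lemma open_dist A : open A <->
  forall p, A p -> exists2 d : R, 0 < d & forall q, `|q - p| < d -> A q.
Proof.
rewrite openE; split=> AP p Ap; first by apply/nbhs_dist/AP.
by apply/nbhs_dist/AP.
Qed.

Lemma compact_closed_dist A B : compact A -> closed B -> A `&` B = set0 ->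
  exists2 eta, 0 < eta & forall u v, A u -> B v -> eta <= `|u - v|.
Proof.
move=> /compact_near_coveringP cA clB AB.
have : \forall eta \near (0 : R)^'+, A `<=` (fun u => forall v, B v -> eta <= `|u - v|).
  apply: cA => u Au.
  have : nbhs u (~` B).
    apply: open_nbhs_nbhs; split; first exact: closed_openC.
    by move=> Bu; have : (A `&` B) u by []; rewrite AB.
  case/nbhs_dist => d d0 dB.
  exists ([set u' | `|u' - u| < d / 2], [set eta | eta < d / 2]).
    split=> /=; first by apply/nbhs_dist; exists (d / 2) => //; lra.
    by apply: nbhs_right_lt; lra.
  move=> [u' eta] /= [u'd etad] v Bv; rewrite leNgt; apply/negP => lt.
  have : `|v - u| < d.
    rewrite (_ : v - u = (u' - u) - (u' - v)); last by vector_ring.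
    by apply: le_lt_trans (ler_normB _ _) _; lra.
  by move/dB; apply.
move=> /(filterI (nbhs_right_gt (0 : R))) /filter_ex[eta [/= eta0 etaA]].
by exists eta => // u v Au Bv; apply: etaA.
Qed.

Definition seg a b : set 'rV[R]_2 := (fun t : R => a + t *: (b - a)) @` `[0, 1].

Lemma line_continuous a b : continuous (fun t : R => a + t *: (b - a)).
Proof.
move=> t; apply: cvgD; first exact: cvg_cst.
by apply: cvgZr_tmp; exact: cvg_id.
Qed.

(** The points reached from [a] by steps shorter than [eta] inside [A] are relatively open and
    closed in [A]. *)
Lemma chained_connected A a b : connected A -> A a -> A b -> chained A a b.
Proof.
move=> cA Aa Ab eta eta0.
pose S := [set x | exists s, [/\ path (step eta) a s, last a s = x
   & forall u, u \in a :: s -> A u]].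
suff SA : S = A by move: Ab; rewrite -{1}SA.
have SsubA : S `<=` A by move=> _ [s [_ <- As]]; apply: As; rewrite mem_last.
have Sstep x y : S x -> A y -> `|y - x| < eta -> S y.
  move=> [s [ps ls As]] Ay xy; exists (rcons s y); split.
  - by rewrite rcons_path ps ls.
  - by rewrite last_rcons.
  - move=> u; rewrite inE mem_rcons inE => /or3P[/eqP->|/eqP->//|us] //.
    by apply: As; rewrite inE us orbT.
apply: cA.
- by exists a; exists [::]; split=> // u; rewrite inE => /eqP->.
- exists [set y | exists2 x, S x & `|y - x| < eta].
    apply/open_dist => p [x Sx px]; exists (eta - `|p - x|); first by rewrite subr_gt0.
    move=> q qp; exists x => //.
    rewrite (_ : q - x = (q - p) + (p - x)); last by vector_ring.
    by apply: le_lt_trans (ler_normD _ _) _; lra.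
  apply/seteqP; split=> [x Sx|x [Ax [y Sy xy]]]; last exact: Sstep xy.
  by split; [exact: SsubA | exists x; rewrite ?subrr ?normr0].
- exists (~` [set y | exists2 x, A x /\ ~ S x & `|y - x| < eta]).
    apply: open_closedC; apply/open_dist => p [x Sx px].
    exists (eta - `|p - x|); first by rewrite subr_gt0.
    move=> q qp; exists x => //.
    rewrite (_ : q - x = (q - p) + (p - x)); last by vector_ring.
    by apply: le_lt_trans (ler_normD _ _) _; lra.
  apply/seteqP; split=> [x Sx|x [Ax nx]].
    split; first exact: SsubA.
    by move=> [y [Ay nSy] xy]; apply: nSy; apply: Sstep Sx Ay _; rewrite distrC.
  by apply: contrapT => nSx; apply: nx; exists x; rewrite ?subrr ?normr0.
Qed.

Lemma path_compact (f : R -> 'rV[R]_2) (s t : R) :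
  {within `[s, t], continuous f} -> compact (f @` `[s, t]).
Proof. by move=> cf; apply: continuous_compact cf (@segment_compact _ _ _). Qed.

Lemma path_connected (f : R -> 'rV[R]_2) (s t : R) :
  {within `[s, t], continuous f} -> connected (f @` `[s, t]).
Proof.
by move=> cf; apply: connected_continuous_connected cf; apply: segment_connected.
Qed.

Lemma segl a b : seg a b a.
Proof. by exists 0; rewrite ?scale0r ?addr0 //= in_itv /= lexx ler01. Qed.

Lemma segr a b : seg a b b.
Proof. by exists 1; rewrite ?scale1r ?subrKC //= in_itv /= lexx ler01. Qed.

Lemma seg_compact a b : compact (seg a b).
Proof. by apply: path_compact; apply: continuous_subspaceT; apply: line_continuous. Qed.

Lemma seg_connected a b : connected (seg a b).
Proof. by apply: path_connected; apply: continuous_subspaceT; apply: line_continuous. Qed.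

Lemma seg_chained a b : chained (seg a b) a b.
Proof. by apply: chained_connected (@seg_connected _ _) (segl _ _) (segr _ _). Qed.

Lemma seg_dist a b p : seg a b p -> `|p - a| <= `|b - a| /\ `|p - b| <= `|b - a|.
Proof.
move=> [t /=]; rewrite in_itv /= => /andP[t0 t1] <-; split.
  rewrite addrC addKr normrZ ger0_norm // ler_piMl //.
rewrite (_ : a + t *: (b - a) - b = - ((1 - t) *: (b - a))); last first.
  by vector_ring.
by rewrite normrN normrZ ger0_norm ?subr_ge0 // ler_piMl //; lra.
Qed.

Lemma component_ball A p q d : connected_component A p q ->
  (forall u, `|u - q| < d -> A u) ->
  forall u, `|u - q| < d -> connected_component A p u.
Proof.
move=> Apq dA u ud; rewrite (same_connected_component Apq).
apply: (connected_component_max (segl q u) _ (@seg_connected q u) (segr q u)).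
by move=> w /seg_dist[wq _]; apply: dA; apply: le_lt_trans ud.
Qed.

Lemma open_component A p : open A -> open (connected_component A p).
Proof.
move=> /open_dist oA; apply/open_dist => q Cq.
have [d d0 dA] := oA q (connected_component_sub Cq).
by exists d => // u; apply: component_ball Cq dA u.
Qed.

(** The points reached form an open set with open complement in [F]. Compactness of [K] is what
    later gives disjoint routes a positive distance. *)
Lemma open_connected_join F a b : open F -> connected F -> F a -> F b ->
  exists K, [/\ compact K, K `<=` F & chained K a b].
Proof.
move=> oF cF Fa Fb.
pose S := [set x | exists K, [/\ compact K, K `<=` F & chained K a x]].
have cSF x : chained F a x -> F x.
  by move=> /(_ 1 ltr01)[s [_ <-]]; apply; rewrite mem_last.
have SF : S `<=` F.
  move=> x [K [_ KF ch]]; apply: cSF; apply: chained_sub ch; exact: KF.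
have Sseg x y : S x -> seg x y `<=` F -> S y.
  move=> [K [cK KF ch]] xyF; exists (K `|` seg x y); split.
  - by apply: compactU => //; apply: seg_compact.
  - by rewrite subUset.
  - apply: (@chained_trans _ _ _ x).
      by apply: chained_sub ch => u; left.
    by apply: chained_sub (seg_chained x y) => u; right.
have /open_dist oF' := oF.
suff SFE : S = F by move: Fb; rewrite -{1}SFE.
have segC x y : seg x y = seg y x.
  suff H u v : seg u v `<=` seg v u by apply/seteqP; split.
  move=> _ [t /= + <-]; rewrite in_itv /= => /andP[t0 t1]; exists (1 - t).
    by rewrite /= in_itv /=; apply/andP; split; lra.
  by vector_ring.
have oS : open S.
  apply/open_dist => x Sx; have [d d0 dF] := oF' x (SF x Sx).
  exists d => // y yx; apply: Sseg Sx _ => w /seg_dist[wx _].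
  by apply: dF; apply: le_lt_trans yx.
have oFS : open (F `\` S).
  apply/open_dist => x [Fx nSx]; have [d d0 dF] := oF' x Fx.
  exists d => // y yx; split; first exact: dF.
  move=> Sy; apply: nSx; apply: Sseg Sy _; rewrite segC => w /seg_dist[wx _].
  by apply: dF; apply: le_lt_trans yx.
apply: cF.
- exists a; exists [set a]; split; first exact: compact_set1.
    by move=> _ ->.
  exact: chained_refl.
- by exists S => //; apply/seteqP; split=> [x Sx|x []//]; split=> //; apply: SF.
- exists (~` (F `\` S)); first exact: open_closedC.
  apply/seteqP; split=> [x Sx|x [Fx nFS]]; first by split; [exact: SF | case].
  by apply: contrapT => nSx; apply: nFS.
Qed.

End PlaneTopology.

(** * Arcs near their ends *)

Section Arcs.
Variable R : realType.
Implicit Types (A B F K : set 'rV[R]_2) (a b c p q v : 'rV[R]_2) (eta eps : R).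

Lemma compact_closed_plane A : compact A -> closed A.
Proof. by apply: compact_closed; exact: norm_hausdorff. Qed.

Lemma arc_compact a b A : is_arc a b A -> compact A.
Proof. by move=> [f [cf _ _ _ ->]]; apply: path_compact. Qed.

Lemma compact_avoid A p : compact A -> ~ A p ->
  exists2 d : R, 0 < d & forall q, A q -> d <= `|q - p|.
Proof.
move=> cA nAp.
have [||d d0 dA] := @compact_closed_dist R [set p] A (@compact_set1 _ p).
- exact: compact_closed_plane.
- by apply/seteqP; split=> // x [->].
- by exists d => // q Aq; rewrite distrC; apply: dA.
Qed.

(** By injectivity, the part of the arc with parameters at least [tau] is a compact set avoiding
    [v]. Points close enough to [v] thus have parameters below [tau], and the arc up to them stays
    near [v]. *)
Lemma arc_end_access v b A eps : is_arc v b A -> 0 < eps ->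
  exists2 d : R, 0 < d & forall q, A q -> `|q - v| < d ->
    exists K, [/\ compact K, K `<=` A, forall x, K x -> `|x - v| < eps & chained K q v].
Proof.
move=> [f [cf finj f0 _ ->]] eps0.
have in01 (t : R) : (t \in `[0, 1]%R) = (0 <= t <= 1) by rewrite in_itv.
have [tau tau0 ftau] : exists2 tau : R, 0 < tau &
    forall t, 0 <= t <= 1 -> t < tau -> `|f t - v| < eps.
  have /subspace_continuousP/(_ 0) := cf.
  have I0 : [set` `[0, 1]%R] (0 : R) by rewrite /= in01 lexx ler01.
  move=> /(_ I0)/cvgrPdist_lt/(_ _ eps0).
  move=> /(nbhs_normP (0 : R)) [tau /= tau0 ftau]; exists tau => // t t01 ttau.
  rewrite distrC -f0; apply: ftau; rewrite /= ?in01 //.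
  by rewrite sub0r normrN ger0_norm //; case/andP: t01.
have ctau : {within `[tau, 1], continuous f}.
  apply: continuous_subspaceW cf => t /=; rewrite !in_itv /= => /andP[ht ->].
  by rewrite andbT (le_trans (ltW tau0)).
have [d d0 dA] : exists2 d : R, 0 < d & forall q, (f @` `[tau, 1]) q -> d <= `|q - v|.
  apply: compact_avoid; first exact: path_compact.
  move=> [t /=]; rewrite in_itv /= => /andP[ht t1] ftv.
  suff t0 : t = 0 by move: ht; rewrite t0; lra.
  apply: finj; rewrite ?in01 ?ftv ?f0 ?lexx ?ler01 ?t1 ?andbT //; lra.
exists d => // q [t /=]; rewrite in01 => /andP[t0 t1] <- {q} ftd.
have ttau : t < tau.
  rewrite ltNge; apply/negP => ht; have := dA (f t); rewrite leNgt ftd; apply: contraPP => //.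
  by move=> _ H; have : false by apply: H; exists t => //=; rewrite in_itv /= ht.
have cft : {within `[0, t], continuous f}.
  apply: continuous_subspaceW cf => s /=; rewrite !in_itv /= => /andP[-> ht] /=.
  exact: le_trans ht t1.
exists (f @` `[0, t]); split.
- exact: path_compact.
- move=> _ [s /= + <-]; rewrite in_itv /= => /andP[s0 st]; exists s => //=.
  by rewrite in01 s0 (le_trans st).
- move=> _ [s /= + <-]; rewrite in_itv /= => /andP[s0 st]; apply: ftau.
    by rewrite s0 (le_trans st).
  exact: le_lt_trans ttau.
- apply: chained_connected; first exact: path_connected.
    by exists t => //=; rewrite in_itv /= lexx t0.
  by exists 0 => //=; rewrite in_itv /= lexx t0.
Qed.

Lemma seg_first_hit A p v : closed A -> A v ->
  exists t, [/\ 0 <= t <= 1, A (p + t *: (v - p)) &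
    forall s, 0 <= s < t -> ~ A (p + s *: (v - p))].
Proof.
move=> clA Av; pose g (t : R) := p + t *: (v - p).
pose S := `[0, 1]%classic `&` (g @^-1` A).
have S1 : S !=set0.
  by exists 1; split; rewrite /= ?in_itv /= ?lexx ?ler01 //= /g scale1r subrKC.
have cS : compact S.
  apply: compact_closedI; first exact: segment_compact.
  by apply: closed_comp => // t _; apply: line_continuous.
have [t] := @compact_EVT_min _ _ (id : R -> R) S S1 cS
  (continuous_subspaceT (fun x => @cvg_id _ _)).
rewrite inE => -[/= t01 At] tmin; exists t; split=> //.
move=> s /andP[s0 st] As; move: t01; rewrite in_itv /= => /andP[_ t1].
suff : t <= s by rewrite leNgt st.
by apply: tmin; rewrite inE; split=> //=; rewrite in_itv /= s0 ltW // (lt_le_trans st).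
Qed.

End Arcs.

(** * Routes from a face to a vertex on its boundary *)

Section PlaneGraphFaces.
Variables (R : realType) (P : plane_graph R).
Implicit Types (F K : set 'rV[R]_2) (p q : 'rV[R]_2) (x y z v : P) (eta eps : R).
Local Notation pt := (@pg_pt R P).
Local Notation arc := (@pg_arc R P).

Lemma support_closed : closed (pg_support P).
Proof.
rewrite -[X in closed X]setCK; apply: open_closedC; apply/open_dist => p nSp.
pose Q (i : P + P * P) (d : R) : Prop := match i with
  | inl z => d <= `|pt z - p|
  | inr (x, y) => edge x y -> forall q, arc x y q -> d <= `|q - p| end.
have [| |d d0 dP] := @finite_min_pos R _ Q.
- move=> [z|[x y]] d d' _ dd' //=; first exact: le_trans.
  by move=> h xy q aq; apply: le_trans dd' _; apply: h.
- move=> [z|[x y]].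
    exists `|pt z - p|; last exact: lexx.
    rewrite normr_gt0 subr_eq0; apply: contra_notN nSp => /eqP<-.
    by left; exists z.
  case xy : (edge x y); last by exists 1; rewrite // /Q xy.
  have [|d d0 dA] := compact_avoid (arc_compact (pg_arc_is_arc xy)) (p := p).
    by move=> ap; apply: nSp; right; exists x, y.
  by exists d => // _; apply: dA.
- exists d => // q qd [[z _ ztq]|[x [y [xy aq]]]].
    by have := dP (inl z); rewrite /= ztq leNgt qd.
  by have := dP (inr (x, y)) xy q aq; rewrite leNgt qd.
Qed.

(** Other vertices and arcs missing [v] keep a positive distance from it; an arc through [v] ends
    there and is followed to its end. Finitely many vertices and arcs admit a common [d]. *)
Lemma support_access v eps : 0 < eps -> exists2 d : R, 0 < d &
  forall q, pg_support P q -> `|q - pt v| < d ->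
  exists K, [/\ compact K, chained K q (pt v) &
    forall u, K u -> pg_support P u /\ `|u - pt v| < eps].
Proof.
move=> eps0.
pose Q (i : P + P * P) (d : R) : Prop := match i with
  | inl z => `|pt z - pt v| < d -> z = v
  | inr (x, y) => edge x y -> forall q, arc x y q -> `|q - pt v| < d ->
     exists K, [/\ compact K, K `<=` arc x y, forall u, K u -> `|u - pt v| < eps
       & chained K q (pt v)] end.
have [| |d d0 dP] := @finite_min_pos R _ Q.
- move=> [z|[x y]] d d' _ dd' h /=; first by move=> lt; apply: h; apply: lt_le_trans dd'.
  by move=> xy q aq qd; apply: h => //; apply: lt_le_trans dd'.
- move=> [z|[x y]].
    have [->|zv] := eqVneq z v; first by exists 1; rewrite // /Q.
    exists `|pt z - pt v|; last by rewrite /Q ltxx.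
    by rewrite normr_gt0 subr_eq0 (inj_eq (@pg_pt_inj _ P)).
  case xy : (edge x y); last by exists 1; rewrite // /Q xy.
  have [av|nav] := pselect (arc x y (pt v)); last first.
    have [d d0 dA] := compact_avoid (arc_compact (pg_arc_is_arc xy)) nav.
    by exists d => // _ q aq; rewrite ltNge dA.
  suff [b ab] : exists b, is_arc (pt v) b (arc x y).
    by have [d d0 dA] := arc_end_access ab eps0; exists d => // _ q; apply: dA.
  have [->|->] := pg_arc_pt xy av.
    by exists (pt y); apply: pg_arc_is_arc.
  by exists (pt x); rewrite (pg_arc_sym xy); apply: pg_arc_is_arc; rewrite edge_sym.
- exists d => // q [[z _ <-]|[x [y [xy aq]]]] qd.
    have -> := dP (inl z) qd; exists [set pt v]; split; first exact: compact_set1.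
      exact: chained_refl.
    by move=> _ ->; rewrite subrr normr0; split=> //; left; exists v.
  have [K [cK Ka Keps ch]] := dP (inr (x, y)) xy q aq qd.
  exists K; split=> // u Ku; split; last exact: Keps.
  by right; exists x, y; split=> //; apply: Ka.
Qed.

(* A face need not contain small circular sectors at a vertex on its boundary; it is
   only used that some boundary point of the face close to the vertex lies on an arc
   ending there, and the last part of the route follows this arc. *)
Lemma face_access F v b eps : faces P F -> F b -> closure F (pt v) -> 0 < eps ->
  exists K, [/\ compact K, chained K b (pt v) &
    forall u, K u -> F u \/ (pg_support P u /\ `|u - pt v| < eps)].
Proof.
move=> [p0 nSp0 FE] Fb clF eps0.
have oC : open (~` pg_support P) by apply: closed_openC; apply: support_closed.
have Fsupp u : F u -> ~ pg_support P u by rewrite FE => /connected_component_sub.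
have [d d0 dP] := support_access v eps0.
have [p [Fp pd]] : exists p, F p /\ `|p - pt v| < d.
  have [|p [Fp pd]] := clF [set q | `|q - pt v| < d]; last by exists p.
  by apply/nbhs_dist; exists d.
have Sv : pg_support P (pt v) by left; exists v.
have [t [t01 At tmin]] := seg_first_hit p support_closed Sv.
set q := p + t *: (pt v - p) in At.
have qd : `|q - pt v| < d.
  apply: le_lt_trans pd; rewrite [leRHS]distrC.
  by have [] : `|q - p| <= `|pt v - p| /\ `|q - pt v| <= `|pt v - p|
    by apply: seg_dist; exists t => //=; rewrite in_itv.
have [K2 [cK2 ch2 K2P]] := dP q At qd.
have [K1 [cK1 K1F ch1]] : exists K, [/\ compact K, K `<=` F & chained K b p].
  apply: open_connected_join => //; rewrite FE; first exact: open_component.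
  exact: component_connected.
have t0 : 0 < t.
  rewrite lt_neqAle eq_sym; case/andP: t01 => -> _; rewrite andbT.
  apply/eqP => t0; apply: (Fsupp p Fp).
  by move: At; rewrite /q t0 scale0r addr0.
(* Before the first hit the segment avoids the support, so it stays in the component of [p]. *)
have segF (s : R) : 0 <= s < t -> F (p + s *: (pt v - p)).
  move=> st; set u := p + _.
  have CpE : F = connected_component (~` pg_support P) p.
    by rewrite FE; apply: same_connected_component; rewrite -FE.
  rewrite CpE; apply: (connected_component_max (segl p u) _ (@seg_connected R p u) (segr p u)).
  move=> _ [w /= + <-]; rewrite in_itv /= => /andP[w0 w1].
  have -> : p + w *: (u - p) = p + (w * s) *: (pt v - p) by rewrite /u; vector_ring.
  apply: tmin; case/andP: st => s0 st; rewrite mulr_ge0 //=.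
  by apply: le_lt_trans st; rewrite ler_piMl.
exists (K1 `|` (seg p q `|` K2)); split.
- by apply: compactU => //; apply: compactU => //; apply: seg_compact.
- apply: (@chained_trans _ _ _ p); first by apply: chained_sub ch1 => u; left.
  apply: (@chained_trans _ _ _ q).
    by apply: chained_sub (seg_chained p q) => u; right; left.
  by apply: chained_sub ch2 => u; right; right.
- move=> u [/K1F|[|/K2P]]; [by left| |by right].
  move=> [w /= + <-]; rewrite in_itv /= => /andP[w0 w1].
  have [->|w1'] := eqVneq w 1.
    have -> : p + 1 *: (q - p) = q by vector_ring.
    right; split=> //; have [] := K2P q; last by [].
    by have [s [_ _ /(_ q (mem_head _ _))]] := ch2 1 ltr01.
  left; have -> : p + w *: (q - p) = p + (w * t) *: (pt v - p) by rewrite /q; vector_ring.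
  apply: segF; rewrite mulr_ge0 ?(ltW t0) //= gtr_pMl // lt_neqAle w1' //.
Qed.

End PlaneGraphFaces.

(** Routes with different nations and different vertices are disjoint: distinct faces avoid each
    other and the support, and on the support each route stays within [eps] of its own vertex.
    Compactness turns this into a uniform gap [eta]. *)
Lemma nations_no_K5_minor (R : realType) (G : sgraph) (P : plane_graph R)
    (F : G -> set 'rV[R]_2) : injective F -> (forall x, faces P (F x)) ->
  ~ exists B : 'I_5 -> {set G + P},
      minor_model (incidence (fun x v => `[< closure (F x) (@pg_pt R P v) >])) B.
Proof.
move=> Finj FP; set inc := fun x v => _; pose pt := @pg_pt R P.
have [b bF] : exists b : G -> 'rV[R]_2, forall x, F x (b x).
  apply: (fin_all_exists (P := fun x p => F x p)) => x; have [p nSp ->] := FP x.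
  by exists p; apply: connected_component_refl.
have [eps eps0 epsP] : exists2 eps : R, 0 < eps & forall vw : P * P,
    vw.1 != vw.2 -> 2 * eps <= `|pt vw.1 - pt vw.2|.
  apply: finite_min_pos => [[v w] d d' /= _ dd' h vw|[v w] /=].
    by apply: le_trans (h vw); lra.
  have [_|vw] := eqVneq v w; first by exists 1.
  exists (`|pt v - pt w| / 2); last by move=> _; lra.
  by rewrite divr_gt0 // normr_gt0 subr_eq0 (inj_eq (@pg_pt_inj _ P)).
have [K KP] : exists K : G * P -> set 'rV[R]_2, forall xv, inc xv.1 xv.2 ->
   [/\ compact (K xv), chained (K xv) (b xv.1) (pt xv.2) &
    forall u, K xv u -> F xv.1 u \/ (pg_support P u /\ `|u - pt xv.2| < eps)].
  apply: (fin_all_exists (P := fun (xv : G * P) K => inc xv.1 xv.2 ->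
   [/\ compact K, chained K (b xv.1) (pt xv.2) &
    forall u, K u -> F xv.1 u \/ (pg_support P u /\ `|u - pt xv.2| < eps)])) => -[x v] /=.
  case xv : (inc x v); last by exists set0.
  have [K ?] := face_access (FP x) (bF x) (asboolW xv) eps0; by exists K.
have Fsupp x u : F x u -> ~ pg_support P u.
  by have [p _ ->] := FP x => /connected_component_sub.
have Fdisj x y u : F x u -> F y u -> x = y.
  move=> Fx Fy; apply: Finj; move: Fx Fy; have [p _ ->] := FP x; have [q _ ->] := FP y.
  by move=> /same_connected_component -> /same_connected_component ->.
have [eta eta0 etaP] : exists2 eta : R, 0 < eta & forall i : (G * P) * (G * P),
    inc i.1.1 i.1.2 -> inc i.2.1 i.2.2 -> i.1.1 != i.2.1 -> i.1.2 != i.2.2 ->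
    forall u u', K i.1 u -> K i.2 u' -> eta <= `|u - u'|.
  apply: finite_min_pos => [[xv yw] d d' _ dd' h /= xv_inc yw_inc xy vw u u' Ku Ku'|[xv yw] /=].
    exact: le_trans dd' (h xv_inc yw_inc xy vw u u' Ku Ku').
  case xv_inc : (inc xv.1 xv.2); last by exists 1.
  case yw_inc : (inc yw.1 yw.2); last by exists 1.
  have [_|xy] := eqVneq xv.1 yw.1; first by exists 1.
  have [_|vw] := eqVneq xv.2 yw.2; first by exists 1.
  have [cK _ KF] := KP _ xv_inc; have [cK' _ KF'] := KP _ yw_inc.
  have [|d d0 dP] := compact_closed_dist cK (compact_closed_plane cK'); last first.
    by exists d => // _ _ _ _ u u'; apply: dP.
  apply/seteqP; split=> // u [/KF[Fu|[Su uv]] /KF'[Fu'|[Su' uw]]].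
  - by rewrite (Fdisj _ _ _ Fu Fu') eqxx in xy.
  - by have := Fsupp _ _ Fu.
  - by have := Fsupp _ _ Fu'.
  - have := epsP (xv.2, yw.2) vw; rewrite leNgt => /negP; apply => /=.
    rewrite (_ : pt xv.2 - pt yw.2 = (u - pt yw.2) - (u - pt xv.2)); last by vector_ring.
    by apply: le_lt_trans (ler_normB _ _) _; lra.
pose pos (u : G + P) := match u with inl x => b x | inr v => pt v end.
pose E (u w : G + P) := match u, w with
  | inl x, inr v | inr v, inl x => K (x, v) | _, _ => set0 end.
apply: (@no_drawn_K5_minor R _ _ (incidence_sym inc) pos E eta) => //.
- move=> [x|x] [y|y] //= xy; first by have [_ ? _] := KP (x, y) xy.
  by apply: chained_sym; have [_ ? _] := KP (y, x) xy.
- have H x v y w : inc x v -> inc y w -> x != y -> v != w ->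
     forall u u', K (x, v) u -> K (y, w) u' -> eta <= `|u - u'|.
    by move=> xv yw xy vw u u'; exact: (etaP ((x, v), (y, w)) xv yw xy vw u u').
  have dis (u w u' w' : G + P) : [disjoint [set u; w]%SET & [set u'; w']%SET]%B ->
      [/\ u != u', u != w', w != u' & w != w'].
    move=> D; have h (z : G + P) : z \in ([set u; w]%SET : {set G + P}) -> z != u' /\ z != w'.
      by move=> /(disjointFr D); rewrite !inE => /negbT/norP.
    have [|? ?] := h u; first by rewrite !inE eqxx.
    by have [|? ?] := h w; first by rewrite !inE eqxx orbT.
  by move=> [x|x] [y|y] [x'|x'] [y'|y'] //= xy xy' /dis[? ? ? ?] u u'; apply: H.
Qed.

Lemma map_graph_separator (R : realType) (G : sgraph) : is_0map_graph R G ->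
  has_clique_based_separator G (3 / 4 : R) (170 * Num.sqrt #|G|%:R).
Proof.
move=> [P [nation [nF [F [[Fn Finj _] edgeE]]]]].
apply: (@incidence_clique_separator R G P
  (fun x v => `[< closure (F x) (@pg_pt R P v) >])).
- move=> x y; split=> [/edgeE[xy [v [cx cy]]]|[xy [v /andP[/asboolP cx /asboolP cy]]]].
    by split=> //; exists v; apply/andP; split; apply/asboolP.
  by apply/edgeE; split=> //; exists v.
- apply: nations_no_K5_minor; first by move=> x y; apply: Finj; rewrite inE.
  by move=> x; apply/nF/Fn.
Qed.

Close Scope classical_set_scope.

(** * Disk graphs in the Euclidean plane *)

Section Bins.
Variable R : realType.
Implicit Types (x y l : R).

(** Meaningful for [0 <= x < k.+1%:R * l], the range on which [inord] keeps its argument. *)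
Definition bin k l x : 'I_k.+1 := inord (Num.trunc (x / l)).

Lemma bin_near k l x y : 0 < l -> 0 <= x < k.+1%:R * l -> 0 <= y < k.+1%:R * l ->
  bin k l x = bin k l y -> `|x - y| < l.
Proof.
move=> l0 /andP[x0 xk] /andP[y0 yk].
have trP u : 0 <= u -> (Num.trunc (u / l))%:R * l <= u < (Num.trunc (u / l)).+1%:R * l.
  move=> u0; have /trunc_itv/andP[h1 h2] : 0 <= u / l by rewrite divr_ge0 // ltW.
  by rewrite -ler_pdivlMr // h1 -ltr_pdivrMr.
have trk u : 0 <= u -> u < k.+1%:R * l -> (Num.trunc (u / l) < k.+1)%N.
  move=> u0 uk; have /andP[h _] := trP u u0.
  by rewrite -(ltr_nat R) -(ltr_pM2r l0) (le_lt_trans h).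
move=> /(congr1 val); rewrite /= !inordK ?trk // => E.
have /andP[x1 x2] := trP x x0; have /andP[y1 y2] := trP y y0.
move: x1 x2; rewrite E => x1 x2; move: x2 y2; rewrite -!natr1 !mulrDl mul1r => x2 y2.
by rewrite ltr_norml; apply/andP; split; lra.
Qed.

End Bins.

Lemma card_window r (A : {set 'I_r}) k :
  (forall i j, i \in A -> j \in A -> (j <= i + k)%N) -> (#|A| <= k.+1)%N.
Proof.
move=> Ak; have [->|/finset.set0Pn[i0 iA]] := eqVneq A finset.set0; first by rewrite cards0.
case: (arg_minnP (fun i : 'I_r => val i) iA) => i {}iA imin.
pose f (j : 'I_r) : 'I_k.+1 := inord (j - i).
have fI : {in A &, injective f}.
  move=> j l jA lA /(congr1 val); have := Ak _ _ iA jA; have := Ak _ _ iA lA.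
  have := imin _ jA; have := imin _ lA => h1 h2 h3 h4.
  rewrite /= !inordK; try by rewrite ltnS leq_subLR.
  by move=> E; apply/val_inj; rewrite -(subnK h2) -(subnK h1) E.
by rewrite -(card_in_imset fI); apply: leq_trans (max_card _) _; rewrite card_ord.
Qed.

(** * Euclidean disks and squares *)

Section DiskGraphSeparator.
Variable R : realType.
Implicit Types (p q u v w z : 'rV[R]_2) (a b t : R).

(** The squared Euclidean norm; the balls of the sup norm [|u|] are squares. *)
Definition sqnorm u : R := u 0 0 ^+ 2 + u 0 1 ^+ 2.

Lemma sqnorm_triangle u v a b : 0 <= a -> 0 <= b ->
  sqnorm u <= a ^+ 2 -> sqnorm v <= b ^+ 2 -> sqnorm (u + v) <= (a + b) ^+ 2.
Proof.
move=> a0 b0; rewrite /sqnorm !mxE.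
set u1 := u 0 0; set u2 := u 0 1; set v1 := v 0 0; set v2 := v 0 1 => ua vb.
have uv : u1 * v1 + u2 * v2 <= a * b.
  apply: le_trans (ler_norm _) _; rewrite -[leRHS]ger0_norm ?mulr_ge0 //.
  rewrite -ler_sqr // ?nnegrE // !real_normK ?num_real // exprMn.
  apply: (@le_trans _ _ ((u1 ^+ 2 + u2 ^+ 2) * (v1 ^+ 2 + v2 ^+ 2))).
    by have := sqr_ge0 (u1 * v2 - u2 * v1); lra.
  by apply: ler_pM; rewrite ?addr_ge0 ?sqr_ge0.
lra.
Qed.

Lemma sqnormZ a u : sqnorm (a *: u) = a ^+ 2 * sqnorm u.
Proof. by rewrite /sqnorm !mxE; ring. Qed.

Lemma norm_le_sqnorm u a : 0 <= a -> sqnorm u <= a ^+ 2 -> `|u| <= a.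
Proof.
move=> a0; rewrite /sqnorm => ua.
have sq (x y : R) : x ^+ 2 + y ^+ 2 <= a ^+ 2 -> `|x| <= a.
  move=> xy; rewrite -[leRHS]ger0_norm // -ler_sqr ?nnegrE // !real_normK ?num_real //.
  by have := sqr_ge0 y; lra.
by case: (norm_coordP u) => ->; [exact: sq ua | rewrite addrC in ua; exact: sq ua].
Qed.

Lemma sqnorm_le_norm u a : 0 <= a -> `|u| <= a / 2 -> sqnorm u <= a ^+ 2.
Proof.
move=> a0 ua.
have sq i : u 0 i ^+ 2 <= (a / 2) ^+ 2.
  rewrite -real_normK ?num_real // ler_sqr ?nnegrE ?divr_ge0 //.
  exact: le_trans (norm_coord u i) ua.
by rewrite /sqnorm; have := sq 0; have := sq 1; have := sqr_ge0 a; lra.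
Qed.

Definition disk c a : set 'rV[R]_2 := fun p => sqnorm (p - c) <= a ^+ 2.

Lemma disk_center c a : disk c a c.
Proof. by rewrite /disk /sqnorm !mxE !subrr expr0n addr0 sqr_ge0. Qed.

Lemma disk_convex c a p q t : 0 <= a -> 0 <= t <= 1 -> disk c a p -> disk c a q ->
  disk c a (p + t *: (q - p)).
Proof.
move=> a0 /andP[t0 t1] Dp Dq; rewrite /disk.
have -> : p + t *: (q - p) - c = (1 - t) *: (p - c) + t *: (q - c) by vector_ring.
rewrite (_ : a = (1 - t) * a + t * a); last by ring.
apply: sqnorm_triangle; rewrite ?mulr_ge0 ?subr_ge0 //.
  by rewrite sqnormZ exprMn ler_wpM2l ?sqr_ge0.
by rewrite sqnormZ exprMn ler_wpM2l ?sqr_ge0.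
Qed.

Lemma disk_crossing c a z t p q : 0 <= a -> disk c a p -> disk c a q ->
  `|p - z| <= t -> t <= `|q - z| -> exists2 w, disk c a w & `|w - z| = t.
Proof.
move=> a0 Dp Dq pt tq.
pose f (s : R) : R := `|(p - z) + s *: ((q - z) - (p - z))|.
have cf : continuous f.
  move=> s; apply: cvg_norm; exact: line_continuous.
have f0 : f 0 = `|p - z| by rewrite /f scale0r addr0.
have f1 : f 1 = `|q - z| by rewrite /f scale1r subrKC.
have [|s s01 fs] := @IVT R f 0 1 t ler01 (continuous_subspaceT cf).
  by rewrite f0 f1 ge_min le_max pt tq orbT.
exists (p + s *: (q - p)).
  by apply: disk_convex => //; move: s01; rewrite in_itv.
by rewrite -fs /f; congr (`|_|); vector_ring.
Qed.

(** Moving [p] by at most [l] towards the center leaves room for a Euclidean ball of radius [l],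
    which contains the square of half-side [l / 2]. *)
Lemma disk_retract c a l p : 0 < l -> l < a -> disk c a p ->
  exists q, `|q - p| <= l /\ forall w, `|w - q| <= l / 2 -> disk c a w.
Proof.
move=> l0 la Dp; have a0 : 0 < a by apply: lt_trans la.
exists (c + (1 - l / a) *: (p - c)); split.
  rewrite (_ : _ - p = - (l / a) *: (p - c)); last by vector_ring.
  rewrite normrZ normrN (ger0_norm (ltW (divr_gt0 l0 a0))).
  have pa := norm_le_sqnorm (ltW a0) Dp.
  by rewrite -[leRHS]mulr1 -mulrA ler_pM2l // ler_pdivrMl // mulr1.
move=> w wq; rewrite /disk; set q := c + _ in wq.
have -> : w - c = (w - q) + (q - c) by vector_ring.
rewrite (_ : a = l + (a - l)); last by ring.
have al0 : 0 <= a - l by rewrite subr_ge0 ltW.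
apply: (sqnorm_triangle (ltW l0) al0); first exact: sqnorm_le_norm (ltW l0) wq.
rewrite (_ : q - c = (1 - l / a) *: (p - c)); last by rewrite /q; vector_ring.
rewrite sqnormZ (_ : a - l = (1 - l / a) * a); last by field; rewrite gt_eqF.
by rewrite exprMn ler_wpM2l ?sqr_ge0.
Qed.

End DiskGraphSeparator.

(** * Clusters of centers of least diameter *)

Section DenseCluster.
Variables (R : realType) (I : finType) (c : I -> 'rV[R]_2) (Q : {set I}).
Implicit Types (S : {set I}).

Definition diam S : R := \big[Num.max/0]_(ij | (ij.1 \in S) && (ij.2 \in S)) `|c ij.1 - c ij.2|.

Lemma diam_ge S i j : i \in S -> j \in S -> `|c i - c j| <= diam S.
Proof.
move=> iS jS; apply: (le_bigmax_cond _ (fun ij => `|c ij.1 - c ij.2|) (j := (i, j))).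
by rewrite /= iS jS.
Qed.

Lemma diam_lt S s : 0 < s -> (forall i j, i \in S -> j \in S -> `|c i - c j| < s) ->
  diam S < s.
Proof. by move=> s0 h; apply/bigmax_ltP; split=> // -[i j] /andP[]; apply: h. Qed.

Lemma dense_cluster k : exists S, [/\ S \subset Q, (#|Q| <= k.+1 * #|S|)%N
  & forall S', S' \subset Q -> diam S' < diam S -> (k.+1 * #|S'| < #|Q|)%N].
Proof.
pose ok S := (S \subset Q) && (#|Q| <= k.+1 * #|S|)%N.
have okQ : ok Q by rewrite /ok subxx leq_pmull.
case: (@arg_minP _ _ {set I} Q ok diam okQ) => S /andP[SQ Sk] Smin.
exists S; split=> // S' S'Q lt; rewrite ltnNge; apply/negP => S'k.
by move: (Smin S'); rewrite /ok S'Q S'k => /(_ isT); rewrite leNgt lt.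
Qed.

Definition near_set (z : 'rV[R]_2) (t : R) : {set I} := [set x in Q | `|c x - z| < t]%SET.

(* The square of half-side [2 s] is covered by 25 squares of side [4 s / 5 < s]. *)
Lemma ball_count (z : 'rV[R]_2) (s : R) m : 0 < s ->
  (forall S, S \subset Q -> diam S < s -> (m * #|S| <= #|Q|)%N) ->
  (m * #|near_set z (2 * s)%R| <= 25 * #|Q|)%N.
Proof.
move=> s0 small; pose B := near_set z (2 * s).
pose l := 4 * s / 5; have l0 : 0 < l by rewrite /l; lra.
pose code x : 'I_5 * 'I_5 :=
  (bin 4 l ((c x - z) 0 0 + 2 * s), bin 4 l ((c x - z) 0 1 + 2 * s)).
have range x i : x \in B -> 0 <= (c x - z) 0 i + 2 * s < 5 * l.
  rewrite inE => /andP[_ xz]; have := le_lt_trans (norm_coord _ i) xz.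
  by rewrite ltr_norml /l => /andP[h1 h2]; apply/andP; split; lra.
pose fiber ab := [set x in B | code x == ab]%SET.
have fiber_small ab : (m * #|fiber ab| <= #|Q|)%N.
  apply: small; first by apply/fintype.subsetP => x; rewrite !inE => /andP[/andP[]].
  have fiberP x : (x \in fiber ab) = (x \in B) && (code x == ab) by rewrite finset.in_set.
  apply: diam_lt => // x y; rewrite !fiberP => /andP[xB /eqP xc] /andP[yB /eqP yc].
  have E : code x = code y by rewrite xc yc.
  have [E0 E1] := (congr1 fst E, congr1 snd E).
  have near i (Ei : bin 4 l ((c x - z) 0 i + 2 * s) = bin 4 l ((c y - z) 0 i + 2 * s)) :
      `|(c x - c y) 0 i| < s.
    have := bin_near l0 (range _ i xB) (range _ i yB) Ei; rewrite !mxE /l => h.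
    rewrite (_ : c x 0 i - c y 0 i = c x 0 i - z 0 i + 2 * s - (c y 0 i - z 0 i + 2 * s)); last by ring.
    by apply: lt_trans h _; lra.
  by case: (norm_coordP (c x - c y)) => ->; apply: near.
have BE : (#|B| <= \sum_(ab : 'I_5 * 'I_5) #|fiber ab|)%N.
  rewrite -sum1_card (partition_big code predT) //=.
  by apply: leq_sum => ab _; rewrite -sum1_card; apply/eq_leq/eq_bigl => x; rewrite [RHS]finset.in_set.
apply: leq_trans (leq_mul (leqnn m) BE) _; rewrite big_distrr /=.
apply: (@leq_trans (\sum_(ab : 'I_5 * 'I_5) #|Q|)); first exact: leq_sum.
by rewrite sum_nat_const card_prod card_ord.
Qed.

End DenseCluster.

Lemma sum_card_exchange (I J : finType) (A : I -> {set J}) k m :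
  (forall j, #|[set i | j \in A i]%SET| <= k)%N -> (#|J| * k < #|I| * m.+1)%N ->
  exists i, (#|A i| <= m)%N.
Proof.
move=> Ak lt; case: (pickP (fun i => #|A i| <= m)%N) => [i|big]; first by exists i.
suff : (#|I| * m.+1 <= #|J| * k)%N by rewrite leqNgt lt.
apply: (@leq_trans (\sum_i #|A i|)%N).
  by rewrite -sum_nat_const; apply: leq_sum => i _; rewrite ltnNge big.
rewrite (eq_bigr (fun i => \sum_j (j \in A i))%N); last first.
  by move=> i _; rewrite -sum1_card big_mkcond /=; apply: eq_bigr => j _; case: (j \in A i).
rewrite exchange_big /= -sum_nat_const; apply: leq_sum => j _.
apply: leq_trans (Ak j); rewrite -sum1_card [leqRHS]big_mkcond /=.
by apply: leq_sum => i _; rewrite inE; case: (j \in A i).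
Qed.

Section DiskGraphs.
(** Only vertices in [Q] are represented by disks; the others form one clique, which will consist of
    the spherical disks containing the pole. *)
Variables (R : realType) (G : sgraph) (Q : {set G}) (c : G -> 'rV[R]_2) (rad : G -> R).
Hypothesis rad_ge0 : forall x, x \in Q -> 0 <= rad x.
Hypothesis cliqueQ : clique (~: Q)%SET.
Hypothesis edgeQ : forall x y, x \in Q -> y \in Q ->
  (edge x y <-> x != y /\ exists p, disk (c x) (rad x) p /\ disk (c y) (rad y) p).
Local Notation n := #|G|.

Section Annulus.
Variables (z : 'rV[R]_2) (s : R) (r : nat).
Hypotheses (s_gt0 : 0 < s) (r_gt0 : (0 < r)%N).

Definition crossing t x := (x \in Q) && `[< exists2 p, disk (c x) (rad x) p & `|p - z| = t >].

Local Notation inner t := (near_set c Q z t).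

(** A common point of the disks lies inside or outside the square of half-side [t]; accordingly the
    disk centered outside or the one centered inside crosses its boundary. *)
Lemma inner_separated t x y : x \in inner t -> y \in Q -> y \notin inner t ->
  ~~ crossing t x -> ~~ crossing t y -> ~~ edge x y.
Proof.
rewrite !inE => /andP[xQ xt] yQ; rewrite yQ /= -leNgt => yt.
rewrite /crossing xQ yQ /= => /asboolPn nx /asboolPn ny.
apply/negP => /(edgeQ xQ yQ)[_ [p [px py]]].
have [pt|tp] := leP t `|p - z|.
  apply: nx; apply: (disk_crossing (rad_ge0 xQ) (disk_center _ _) px) => //; exact: ltW.
by apply: ny; apply: (disk_crossing (rad_ge0 yQ) py (disk_center _ _)) => //; exact: ltW.
Qed.

Definition width : R := s / r%:R.

Let r0 : (0 : R) < r%:R. Proof. by rewrite ltr0n. Qed.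

Let width_gt0 : 0 < width. Proof. exact: divr_gt0. Qed.

Definition level (j : 'I_r) : R := s + j%:R * width.

Lemma level_bounds j : s <= level j < 2 * s.
Proof.
rewrite /level lerDl mulr_ge0 ?(ltW width_gt0) //=.
have : (j%:R : R) < r%:R by rewrite ltr_nat.
rewrite -(ltr_pM2r width_gt0) /width [r%:R * _]mulrC divfK ?gt_eqF //; lra.
Qed.

(* By averaging, some level is crossed by few tiny disks, which become singletons; the
   other disks crossing it contain a whole cell of a grid of mesh [width / 2], and only
   linearly many such cells are close to the level. *)
Definition tiny x := rad x <= width.

(** The distance from [z] to the center of a tiny disk is within [width] of each level that the disk
    crosses, so these levels are at most two indices apart. *)
Lemma tiny_crossing_count x :
  (#|[set j | tiny x && crossing (level j) x]%SET| <= 3)%N.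
Proof.
apply: card_window => i j; rewrite !inE.
have near k : tiny x && crossing (level k) x -> `| `|c x - z| - level k| <= width.
  case/and3P=> tx xQ /asboolP[p px <-]; apply: le_trans (ler_dist_dist _ _) _.
  rewrite (_ : c x - z - (p - z) = - (p - c x)); last by vector_ring.
  rewrite normrN; apply: le_trans tx; exact: norm_le_sqnorm (rad_ge0 xQ) px.
move=> /near; rewrite ler_norml => /andP[i1 i2] /near; rewrite ler_norml => /andP[j1 j2].
have : (j%:R - i%:R) * width <= 2 * width.
  by rewrite mulrBl; move: i1 i2 j1 j2; rewrite /level; lra.
by rewrite ler_pM2r // lerBlDr -natrD ler_nat addnC.
Qed.

(** Two booleans for the side of the square, then bins of mesh [width / 2]: 5 of them cover the
    range [2 * width] across the side, and [12 * r + 1] the range [6 * s] along it, as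
    [r * width = s]. *)
Definition cell := (bool * bool * 'I_5 * 'I_(12 * r).+1)%type.

Definition cell_of t p q : cell :=
  let b := `|(p - z) 0 0| == t in
  let i : 'I_2 := if b then 0 else 1 in
  let i' : 'I_2 := if b then 1 else 0 in
  let pos := 0 <= (p - z) 0 i in
  (b, pos, bin 4 (width / 2) ((q - z) 0 i - (if pos then t else - t) + width),
   bin (12 * r) (width / 2) ((q - z) 0 i' + 3 * s)).

Lemma cell_near t p q p' q' : s <= t < 2 * s ->
  `|p - z| = t -> `|q - p| <= width -> `|p' - z| = t -> `|q' - p'| <= width ->
  cell_of t p q = cell_of t p' q' -> `|q' - q| <= width / 2.
Proof.
move=> /andP[st ts] pt qp pt' qp'; have h0 : 0 < width / 2 by rewrite divr_gt0.
have wr : r%:R * width = s by rewrite /width mulrC divfK ?gt_eqF.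
have ws : width <= s by rewrite -wr ler_peMl ?ler1n // ltW.
have H u v : `|u - z| = t -> `|v - u| <= width ->
    let b := `|(u - z) 0 0| == t in
    let i : 'I_2 := if b then 0 else 1 in
    let i' : 'I_2 := if b then 1 else 0 in
    0 <= (v - z) 0 i - (if 0 <= (u - z) 0 i then t else - t) + width < 5 * (width / 2) /\
    0 <= (v - z) 0 i' + 3 * s < (12 * r).+1%:R * (width / 2).
  move=> ut vu b i i'; have ui : `|(u - z) 0 i| = t.
    rewrite /i /b; case: eqP => // ne; case: (norm_coordP (u - z)); rewrite ut //.
    by move=> E; case: ne.
  have vuc k : - width <= (v - z) 0 k - (u - z) 0 k <= width.
    have := le_trans (norm_coord (v - u) k) vu; rewrite ler_norml !mxE.
    by move=> /andP[h1 h2]; apply/andP; split; lra.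
  split.
    have /andP[h1 h2] := vuc i.
    case: (leP 0 ((u - z) 0 i)) ui => [u0|u0] ui; [rewrite ger0_norm // in ui | rewrite ltr0_norm // in ui];
      apply/andP; split; lra.
  have := norm_coord (u - z) i'; rewrite ut ler_norml => /andP[u1 u2].
  have /andP[h1 h2] := vuc i'.
  have -> : (12 * r).+1%:R * (width / 2) = 6 * s + width / 2.
    by rewrite -[(12 * r).+1%:R]natr1 natrM -wr; field.
  by apply/andP; split; lra.
have [ra rb] := H p q pt qp; have [ra' rb'] := H p' q' pt' qp'.
move=> [Eb Es Ea Eo].
have near (x y : R) : `|x - y| < width / 2 -> `|y - x| <= width / 2.
  by rewrite distrC; apply: ltW.
move: ra rb Ea Eo; rewrite Es Eb => ra rb /(bin_near h0 ra ra')/near na /(bin_near h0 rb rb')/near nb.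
have cc k x : (q' - z) 0 k + x - ((q - z) 0 k + x) = (q' - q) 0 k by rewrite !mxE; ring.
move: na nb; rewrite -![_ - _ + width]addrA !cc.
by case: (norm_coordP (q' - q)) => ->; case: ifP.
Qed.

Lemma annulus_separator (S0 : {set G}) :
  (n <= r * r)%N -> S0 \subset Q -> (#|Q| <= 26 * #|S0|)%N ->
  (forall x, x \in S0 -> `|c x - z| <= s) ->
  (26 * #|inner (2 * s)%R| <= 25 * #|Q|)%N ->
  has_clique_based_separator G (25 / 26 : R) (264 * r%:R).
Proof.
move=> nr SQ QS Sz inner2.
(* Each vertex is counted at no more than 3 levels, and [3 * n < r * (3 * r + 1)]. *)
have [||j jtiny] := @sum_card_exchange 'I_r G
  (fun j => [set x | tiny x && crossing (level j) x]%SET) 3 (3 * r).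
- move=> x; apply: leq_trans (tiny_crossing_count x); apply/eq_leq/eq_card => j.
  by rewrite !inE.
- by rewrite card_ord; nia.
have st := level_bounds j; set t := level j in jtiny st; have /andP[st1 st2] := st.
have [pq pqP] : exists pq : G -> 'rV[R]_2 * 'rV[R]_2, forall x, crossing t x -> ~~ tiny x ->
    [/\ `|(pq x).1 - z| = t, `|(pq x).2 - (pq x).1| <= width
      & forall w, `|w - (pq x).2| <= width / 2 -> disk (c x) (rad x) w].
  apply: (fin_all_exists (P := fun x pq => crossing t x -> ~~ tiny x ->
    [/\ `|pq.1 - z| = t, `|pq.2 - pq.1| <= width
      & forall w, `|w - pq.2| <= width / 2 -> disk (c x) (rad x) w])) => x.
  have [/andP[xQ /asboolP[p px pt]]|] := boolP (crossing t x); last by exists (0, 0).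
  have [_|] := boolP (tiny x); first by exists (0, 0).
  rewrite /tiny -ltNge => wx; have [q [qp qx]] := disk_retract width_gt0 wx px.
  by exists (p, q).
pose X := (~: Q :|: [set x | crossing t x])%SET.
(* [None] codes the clique outside [Q], tiny disks are singletons, and the others are grouped by the
   cell of a point deep inside them. *)
pose code x : option (G + cell) := if x \in Q then
  Some (if tiny x then inl x else inr (cell_of t (pq x).1 (pq x).2)) else None.
have XP x : x \notin X -> x \in Q /\ ~~ crossing t x.
  by rewrite !inE negb_or negbK => /andP.
apply: (@clique_separatorI R G _ _ X (inner t) _ code).
- move=> x y; rewrite !inE /code => xX yX xy.
  case xQ : (x \in Q) xX => /= xX; case yQ : (y \in Q) yX => //= yX; last first.
    by move=> _; apply: cliqueQ; rewrite ?inE ?xQ ?yQ.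
  case tx : (tiny x); case ty : (tiny y) => // E.
    have xy' : x = y by congruence.
    by rewrite xy' eqxx in xy.
  have {}E : cell_of t (pq x).1 (pq x).2 = cell_of t (pq y).1 (pq y).2 by congruence.
  apply/(edgeQ xQ yQ); split=> //; exists (pq y).2.
  have [px qx dx] := pqP x xX (negbT tx); have [py qy dy] := pqP y yX (negbT ty).
  split; last by apply: dy; rewrite subrr normr0 ltW // divr_gt0.
  by apply: dx; apply: cell_near st px qx py qy E.
- move=> x y /XP[xQ xt] /XP[yQ yt] xi yi; exact: inner_separated xi yQ yi xt yt.
- have : (26 * #|(inner t :\: X)%SET| <= 25 * n)%N.
    apply: (@leq_trans (26 * #|inner (2 * s)%R|)).
      rewrite leq_mul2l /=; apply: subset_leq_card; apply/fintype.subsetP => x.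
      by rewrite !inE => /andP[_ /andP[-> xt]]; apply: lt_trans st2.
    by apply: leq_trans inner2 _; rewrite leq_mul2l max_card.
  rewrite -(ler_nat R) !natrM; lra.
(* No vertex of [S0] lies outside: its center is within [s <= t] of [z], and if the distance equals
   [t], the disk crosses and belongs to [X]. *)
- have : (26 * #|(~: (inner t :|: X))%SET| <= 25 * n)%N.
    apply: (@leq_trans (26 * #|(Q :\: S0)%SET|)).
      rewrite leq_mul2l /=; apply: subset_leq_card; apply/fintype.subsetP => x.
      rewrite inE finset.in_setU negb_or => /andP[xi /XP[xQ xt]].
      rewrite finset.in_setD xQ andbT; apply: contra xi => xS; rewrite inE xQ /=.
      rewrite lt_neqAle (le_trans (Sz x xS) st1) andbT.
      apply: contra xt => /eqP xt; rewrite /crossing xQ; apply/asboolP.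
      by exists (c x) => //; apply: disk_center.
    have := cardsID S0 Q; rewrite (finset.setIidPr SQ) => QE.
    have : (#|Q| <= n)%N by apply: max_card.
    lia.
  rewrite -(ler_nat R) !natrM; lra.
(* This count is [243 * r + 21], at most [264 * r]. *)
- have : (#|(code @: X)%SET| <= 1 + (3 * r + 20 * (12 * r).+1))%N.
    pose Y : {set option (G + cell)} := (None |: (Some @: ((inl @:
      [set x | tiny x && crossing t x]) :|: (inr @: [set: cell]))))%SET.
    apply: (@leq_trans #|Y|).
      apply: subset_leq_card; apply/fintype.subsetP => _ /imsetP[x xX ->]; rewrite /code.
      case xQ : (x \in Q); last by rewrite !inE.
      rewrite !inE /=; apply: imset_f; rewrite inE.
      have xt : crossing t x by move: xX; rewrite !inE xQ.
      by case tx : (tiny x); [rewrite imset_f // inE tx | rewrite orbC imset_f // inE].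
    apply: leq_trans (leq_card_setU _ _) _; rewrite cards1 leq_add2l.
    rewrite card_imset; last by move=> ? ? [].
    apply: leq_trans (leq_card_setU _ _) (leq_add _ _).
      by apply: leq_trans (leq_imset_card _ _) jtiny.
    apply: leq_trans (leq_imset_card _ _) _.
    by rewrite cardsT !card_prod !card_bool !card_ord.
  move=> codeX; rewrite -natrM ler_nat; apply: leq_trans codeX _; lia.
Qed.

End Annulus.

Theorem disk_graph_separator :
  has_clique_based_separator G (25 / 26 : R) (528 * Num.sqrt n%:R).
Proof.
have [G0|G0] := posnP n; first exact: empty_graph_separator.
have [r [r0 nr rn]] := exists_nat_sqrt R G0.
have r1 : (1 : R) <= r%:R by rewrite ler1n.
(* The fraction is [1 / 26], one more than the 25 squares of [ball_count], so that a fixed fraction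
   of [Q] stays outside the inner side. *)
have [S0 [SQ QS Smin]] := dense_cluster c Q 25.
(* If all centers of [S0] coincide, then [S0] is a clique; at most two cliques form the separator,
   with one side empty. *)
have [s0|] := leP (diam c S0) 0.
  have cS x y : x \in S0 -> y \in S0 -> c x = c y.
    move=> xS yS; apply/eqP; rewrite -subr_eq0 -normr_le0.
    exact: le_trans (diam_ge c xS yS) s0.
  apply: (@clique_separatorI R G _ _ (~: Q :|: S0)%SET finset.set0 bool (fun x => x \in Q)).
  - move=> x y; rewrite !inE => xX yX xy E; move: xX yX; rewrite -E.
    case xQ : (x \in Q) => /= xX yX; last by apply: cliqueQ; rewrite ?inE -?E ?xQ.
    have yQ : y \in Q by rewrite -E.
    apply/(edgeQ xQ yQ); split=> //; exists (c x).
    by split; [|rewrite (cS x y)//]; apply: disk_center.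
  - by move=> x y _ _; rewrite inE.
  - by rewrite finset.set0D cards0 mulr_ge0.
  - have : (26 * #|(~: (finset.set0 :|: (~: Q :|: S0)))%SET| <= 25 * n)%N.
      have -> : (~: (finset.set0 :|: (~: Q :|: S0)) = Q :\: S0)%SET.
        by apply/finset.setP => x; rewrite !inE; case: (x \in Q); case: (x \in S0).
      have := cardsID S0 Q; rewrite (finset.setIidPr SQ) => QE.
      have : (#|Q| <= n)%N by apply: max_card.
    lia.
    rewrite -(ler_nat R) !natrM; lra.
  - apply: (@le_trans _ _ 2%:R); last by lra.
    by rewrite ler_nat -card_bool max_card.
move=> s0.
have [x0 xS] : exists x0, x0 \in S0.
  apply/finset.set0Pn; apply: contraTneq s0 => ->; rewrite -leNgt.
  by rewrite /diam big_pred0 // => ij; rewrite inE.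
have inner2 : (26 * #|near_set c Q (c x0) (2 * diam c S0)%R| <= 25 * #|Q|)%N.
  by apply: ball_count => // S SQ' lt; apply/ltnW/Smin.
have := annulus_separator s0 r0 nr SQ QS (fun x xS' => diam_ge c xS' xS) inner2.
move=> [S [cS Sc]]; exists S; split=> //; lra.
Qed.

End DiskGraphs.

(** * Unit disk, hyperbolic and spherical disk graphs *)

Section Coordinates.
Variable R : realType.

Lemma dotprod2E (u v : 'rV[R]_2) : dotprod u v = u 0 0 * v 0 0 + u 0 1 * v 0 1.
Proof.
rewrite /dotprod !big_ord_recl big_ord0 addr0.
by congr (_ + u _ _ * v _ _); apply/val_inj.
Qed.

Lemma dotprod3E (u v : 'rV[R]_3) :
  dotprod u v = u 0 0 * v 0 0 + u 0 1 * v 0 1 + u 0 2%:R * v 0 2%:R.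
Proof.
rewrite /dotprod !big_ord_recl big_ord0 addr0 addrA.
by congr (_ + u _ _ * v _ _ + u _ _ * v _ _); apply/val_inj.
Qed.

Definition vec2 (a b : R) : 'rV[R]_2 := \row_i nth 0 [:: a; b] i.
Definition vec3 (a b d : R) : 'rV[R]_3 := \row_i nth 0 [:: a; b; d] i.

Lemma vec2E a b : (vec2 a b 0 0 = a) * (vec2 a b 0 1 = b).
Proof. by rewrite !mxE. Qed.

Lemma vec3E a b d :
  (vec3 a b d 0 0 = a) * (vec3 a b d 0 1 = b) * (vec3 a b d 0 2%:R = d).
Proof. by rewrite !mxE. Qed.

Lemma rV2P (u v : 'rV[R]_2) : u 0 0 = v 0 0 -> u 0 1 = v 0 1 -> u = v.
Proof.
move=> E0 E1; apply/rowP => -[[|[|//]] lt2].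
  by move: E0; congr (u _ _ = v _ _); apply/val_inj.
by move: E1; congr (u _ _ = v _ _); apply/val_inj.
Qed.

End Coordinates.

Lemma unit_disk_graph_separator (R : realType) (G : sgraph) : is_unit_disk_graph R G ->
  has_clique_based_separator G (25 / 26 : R) (528 * Num.sqrt #|G|%:R).
Proof.
move=> [rho [c [rho0 edgeE]]].
have diskE x u : euclidean_disk rho (c x) u <-> disk (c x) rho u.
  rewrite /euclidean_disk /= /euclidean_dist /disk dotprod2E -!expr2 -/(sqnorm _).
  by rewrite -[X in _ <= X](ger0_norm (ltW rho0)) -sqrtr_sqr ler_sqrt ?sqr_ge0.
apply: (@disk_graph_separator R G [set: G]%SET c (fun=> rho)).
- by move=> x _; apply: ltW.
- by move=> x y; rewrite !inE.
- move=> x y _ _; split=> [/edgeE[xy [u [/diskE ux /diskE uy]]]|[xy [u [ux uy]]]].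
    by split=> //; exists u.
  by apply/edgeE; split=> //; exists u; split; apply/diskE.
Qed.

(** * Hyperbolic disks in the Poincare model *)

Section Hyperbolic.
Variable R : realType.
Implicit Types (u c : 'rV[R]_3) (p : 'rV[R]_2) (r : R).

Definition cosh r : R := (expR r + expR (- r)) / 2.
Definition sinh r : R := (expR r - expR (- r)) / 2.

Lemma cosh2_sinh2 r : cosh r ^+ 2 - sinh r ^+ 2 = 1.
Proof.
have E : expR r * expR (- r) = 1 by rewrite expRN mulfV // gt_eqF // expR_gt0.
by rewrite -[RHS]E /cosh /sinh; field.
Qed.

Lemma sinh_gt0 r : 0 < r -> 0 < sinh r.
Proof. by move=> r0; rewrite divr_gt0 // subr_gt0 ltr_expR; lra. Qed.

Lemma sinh_lt_cosh r : sinh r < cosh r.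
Proof. by rewrite ltr_pM2r ?invr_gt0 // ltrD2l; have := expR_gt0 (- r); lra. Qed.

Lemma lorentz_gt0 u c : hyperbolic_plane u -> hyperbolic_plane c -> 0 < lorentz u c.
Proof.
rewrite /hyperbolic_plane /= /lorentz => -[].
set a := u 0 0; set b := u 0 1; set z := u 0 2%:R => u1 z0 [].
set a' := c 0 0; set b' := c 0 1; set z' := c 0 2%:R => c1 z'0.
rewrite -addrA -opprD subr_gt0; apply: le_lt_trans (ler_norm _) _.
have zz' := mulr_gt0 z0 z'0; rewrite -[ltRHS]gtr0_norm //.
rewrite -ltr_sqr ?nnegrE // !real_normK ?num_real //.
have h := sqr_ge0 (a * b' - b * a').
have e1 : z * z = 1 + a * a + b * b by lra.
have e2 : z' * z' = 1 + a' * a' + b' * b' by lra.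
have -> : (z * z') ^+ 2 = (z * z) * (z' * z') by ring.
rewrite e1 e2.
have := sqr_ge0 a; have := sqr_ge0 b; have := sqr_ge0 a'; have := sqr_ge0 b'.
lra.
Qed.

(** The function inside the logarithm is increasing for positive arguments and takes the value
    [expR r] at [cosh r]. *)
Lemma hyperbolic_diskE u c r : 0 < r -> hyperbolic_plane u -> hyperbolic_plane c ->
  (hyperbolic_dist u c <= r) = (lorentz u c <= cosh r).
Proof.
move=> r0 hu hc; have L0 := lorentz_gt0 hu hc.
rewrite /hyperbolic_dist /arcosh; set L := lorentz u c in L0 *.
have s0 := sinh_gt0 r0; have sc := sinh_lt_cosh r.
have C0 : 0 < cosh r by lra.
have SE : Num.sqrt (cosh r ^+ 2 - 1) = sinh r.
  have -> : cosh r ^+ 2 - 1 = sinh r ^+ 2 by have := cosh2_sinh2 r; lra.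
  by rewrite sqrtr_sqr gtr0_norm.
have E : expR r = cosh r + sinh r by rewrite /cosh /sinh; field.
have w0 : 0 < L + Num.sqrt (L ^+ 2 - 1) by rewrite ltr_wpDr ?sqrtr_ge0.
rewrite -ler_expR lnK ?posrE // E -SE.
have [LC|CL] := leP L (cosh r).
  by rewrite lerD // ler_wsqrtr // lerD2r ler_sqr ?nnegrE // ltW.
apply/negbTE; rewrite -ltNge ltr_leD // ler_wsqrtr // lerD2r.
by rewrite ler_sqr ?nnegrE; apply: ltW.
Qed.

(* Stereographic projection of the hyperboloid from [(0, 0, -1)], which maps it onto
   the unit disk (the Poincare model). *)
Definition poincare u : 'rV[R]_2 := vec2 (u 0 0 / (1 + u 0 2%:R)) (u 0 1 / (1 + u 0 2%:R)).

Definition poincare_center r c : 'rV[R]_2 :=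
  vec2 (c 0 0 / (c 0 2%:R + cosh r)) (c 0 1 / (c 0 2%:R + cosh r)).

Definition poincare_radius r c : R := sinh r / (c 0 2%:R + cosh r).

(** Squared distance minus squared radius is [lorentz u c - cosh r] times a positive factor. *)
Lemma poincare_disk u c r : 0 < r -> hyperbolic_plane u -> hyperbolic_plane c ->
  hyperbolic_disk r c u <-> disk (poincare_center r c) (poincare_radius r c) (poincare u).
Proof.
move=> r0 hu hc; have s0 := sinh_gt0 r0; have sc := sinh_lt_cosh r.
have cs := cosh2_sinh2 r.
suff -> : disk (poincare_center r c) (poincare_radius r c) (poincare u) =
    (lorentz u c <= cosh r) :> Prop.
  by rewrite -(hyperbolic_diskE r0 hu hc); split=> [[]|].
move: hu hc; rewrite /hyperbolic_plane /= /disk /sqnorm.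
rewrite /poincare /poincare_center /poincare_radius /lorentz.
move: (cosh r) (sinh r) s0 sc cs => C S s0 sc cs.
rewrite ![((_ - _) : 'rV[R]_2) _ _]mxE ![(- _ : 'rV[R]_2) _ _]mxE !vec2E.
set a := u 0 0; set b := u 0 1; set z := u 0 2%:R => -[u1 z0].
set a' := c 0 0; set b' := c 0 1; set z' := c 0 2%:R => -[c1 z'0].
have zn : 1 + z != 0 by rewrite gt_eqF //; lra.
have zn' : z' + C != 0 by rewrite gt_eqF //; lra.
rewrite -subr_le0 -[X in _ = is_true X]subr_le0.
have -> : (a / (1 + z) - a' / (z' + C)) ^+ 2 + (b / (1 + z) - b' / (z' + C)) ^+ 2 -
   (S / (z' + C)) ^+ 2 = (z * z' - a * a' - b * b' - C) * (2 / ((1 + z) * (z' + C))).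
  have -> : (a / (1 + z) - a' / (z' + C)) ^+ 2 + (b / (1 + z) - b' / (z' + C)) ^+ 2 -
    (S / (z' + C)) ^+ 2 = (a * a + b * b) / (1 + z) ^+ 2
    - 2 * (a * a' + b * b') / ((1 + z) * (z' + C)) + (a' * a' + b' * b' - S ^+ 2) / (z' + C) ^+ 2.
    by field; rewrite zn zn'.
  have -> : a * a + b * b = z * z - 1 by lra.
  have -> : a' * a' + b' * b' - S ^+ 2 = z' * z' - C ^+ 2 by lra.
  by field; rewrite zn zn'.
by rewrite pmulr_lle0 // divr_gt0 // mulr_gt0 //; lra.
Qed.

Lemma poincare_onto p : sqnorm p < 1 -> exists2 u, hyperbolic_plane u & poincare u = p.
Proof.
move=> p1; set q := sqnorm p in p1; have q1 : 1 - q != 0 by rewrite gt_eqF //; lra.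
have q0 : 0 <= q by rewrite addr_ge0 ?sqr_ge0.
exists (vec3 (2 * p 0 0 / (1 - q)) (2 * p 0 1 / (1 - q)) ((1 + q) / (1 - q))).
  rewrite /hyperbolic_plane /= /lorentz !vec3E; split; last by rewrite divr_gt0 //; lra.
  have -> : (1 + q) / (1 - q) * ((1 + q) / (1 - q)) -
    2 * p 0 0 / (1 - q) * (2 * p 0 0 / (1 - q)) - 2 * p 0 1 / (1 - q) * (2 * p 0 1 / (1 - q)) =
    ((1 + q) ^+ 2 - 4 * (p 0 0 ^+ 2 + p 0 1 ^+ 2)) / (1 - q) ^+ 2 by field.
  by rewrite -/(sqnorm p) -/q; field.
have d2 : 1 + (1 + q) / (1 - q) = 2 / (1 - q) by field.
by apply: rV2P; rewrite /poincare !vec2E !vec3E d2; field.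
Qed.

(** Ensures that a common point of two Euclidean disks comes from the hyperboloid. With [z] the last
    coordinate of [c], the center has norm at most [z / (z + cosh r)], the radius is
    [sinh r / (z + cosh r)], and [sinh r < cosh r]. *)
Lemma poincare_disk_sub r c p : 0 < r -> hyperbolic_plane c ->
  disk (poincare_center r c) (poincare_radius r c) p -> sqnorm p < 1.
Proof.
move=> r0; rewrite /hyperbolic_plane /= /lorentz /disk /poincare_center /poincare_radius.
have s0 := sinh_gt0 r0; have sc := sinh_lt_cosh r.
move: (cosh r) (sinh r) s0 sc => C S s0 sc.
set a := c 0 0; set b := c 0 1; set z := c 0 2%:R => -[c1 z0]; set m := vec2 _ _ => pm.
have zC : 0 < z + C by lra.
have m1 : sqnorm m <= (z / (z + C)) ^+ 2.
  rewrite /sqnorm !vec2E !expr_div_n -mulrDl ler_wpM2r ?invr_ge0 ?sqr_ge0 //; lra.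
have zz : 0 <= z / (z + C) by rewrite divr_ge0 // ltW.
have ss : 0 <= S / (z + C) by rewrite divr_ge0 // ltW.
have := sqnorm_triangle zz ss m1 pm; rewrite addrC subrK => /le_lt_trans; apply.
rewrite -mulrDl expr_lt1 ?divr_ge0 //; [|lra|lra].
by rewrite ltr_pdivrMr // mul1r; lra.
Qed.

Lemma hyperbolic_disk_graph_separator r (G : sgraph) : 0 < r -> is_hyperbolic_disk_graph r G ->
  has_clique_based_separator G (25 / 26 : R) (528 * Num.sqrt #|G|%:R).
Proof.
move=> r0 [c [hc edgeE]].
apply: (@disk_graph_separator R G [set: G]%SET (fun x => poincare_center r (c x))
  (fun x => poincare_radius r (c x))).
- move=> x _; have s0 := sinh_gt0 r0; have sc := sinh_lt_cosh r; have [_ z0] := hc x.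
  by rewrite divr_ge0 // ltW //; lra.
- by move=> x y; rewrite !inE.
- move=> x y _ _; split=> [/edgeE[xy [u [ux uy]]]|[xy [p [px py]]]].
    have hu : hyperbolic_plane u by case: ux.
    by split=> //; exists (poincare u); split; apply/poincare_disk.
  have [u hu uE] := poincare_onto (poincare_disk_sub r0 (hc x) px).
  apply/edgeE; split=> //; exists u.
  by split; apply/poincare_disk => //; rewrite uE.
Qed.

(** With this lower bound, a separator size independent of [r] implies the claimed one. It rests on
    [1 - expR (- (2 * r)) <= 2 * r]. *)
Lemma tanh_factor_ge r : 0 < r -> 1 / 2 <= Num.sqrt (r / tanh r).
Proof.
move=> r0; have e0 := expR_gt0 r; have e0' := expR_gt0 (- r).
have t0 : 0 < tanh r.
  by rewrite divr_gt0 //; [rewrite subr_gt0 ltr_expR; lra | lra].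
have tr : tanh r <= 2 * r.
  rewrite ler_pdivrMr; last by lra.
  have h : expR (- r) = expR r * expR (- (2 * r)) by rewrite -expRD; congr expR; ring.
  have h1 := expR_ge1Dx (- (2 * r)).
  have : expR r - expR (- r) <= 2 * r * expR r.
    by rewrite h -[X in X - _]mulr1 -mulrBr [leRHS]mulrC ler_pM2l //; lra.
  by have := mulr_ge0 (ltW r0) (ltW e0'); lra.
have -> : 1 / 2 = Num.sqrt (1 / 4) :> R.
  by rewrite (_ : 1 / 4 = (1 / 2) ^+ 2) ?sqrtr_sqr ?ger0_norm //; field.
rewrite ler_wsqrtr // ler_pdivlMr //; lra.
Qed.

End Hyperbolic.

(** * Spherical disks under stereographic projection *)

Section Spherical.
Variable R : realType.
Implicit Types (u c : 'rV[R]_3) (p : 'rV[R]_2) (r : R).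

Lemma spherical_diskE u c r : 0 < r < pi -> sphere2 u -> sphere2 c ->
  (spherical_dist u c <= r) = (cos r <= dotprod u c).
Proof.
rewrite /sphere2 /= /spherical_dist => /andP[r0 rpi] u1 c1.
have d1 : -1 <= dotprod u c <= 1.
  have : dotprod u c ^+ 2 <= 1.
    move: u1 c1; rewrite !dotprod3E.
    set a := u 0 0; set b := u 0 1; set z := u 0 2%:R => u1.
    set a' := c 0 0; set b' := c 0 1; set z' := c 0 2%:R => c1.
    have E : (a * a + b * b + z * z) * (a' * a' + b' * b' + z' * z') = 1.
      by rewrite u1 c1 mulr1.
    have := sqr_ge0 (a * b' - b * a'); have := sqr_ge0 (a * z' - z * a').
    by have := sqr_ge0 (b * z' - z * b'); lra.
  by move=> d2; rewrite -ler_norml -(@expr_le1 _ 2) // real_normK ?num_real.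
have acos_in : acos (dotprod u c) \in `[0, pi].
  by rewrite in_itv /= acos_ge0 // acos_lepi.
have r_in : r \in `[0, pi] by rewrite in_itv /= !ltW.
by rewrite leNgt -(ltr_cos r_in acos_in) -leNgt acosK //.
Qed.

(* Stereographic projection of the sphere from the pole [(0, 0, 1)]. *)
Definition stereo u : 'rV[R]_2 := vec2 (u 0 0 / (1 - u 0 2%:R)) (u 0 1 / (1 - u 0 2%:R)).

Definition stereo_center r c : 'rV[R]_2 :=
  vec2 (c 0 0 / (cos r - c 0 2%:R)) (c 0 1 / (cos r - c 0 2%:R)).

Definition stereo_radius r c : R := sin r / (cos r - c 0 2%:R).

(** Squared distance minus squared radius is [cos r - dotprod u c] times a positive factor. *)
Lemma stereo_disk u c r : 0 < r < pi -> sphere2 u -> sphere2 c ->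
  u 0 2%:R < 1 -> c 0 2%:R < cos r ->
  spherical_disk r c u <-> disk (stereo_center r c) (stereo_radius r c) (stereo u).
Proof.
move=> r0 hu hc zu zc; have cs := cos2Dsin2 r.
suff -> : disk (stereo_center r c) (stereo_radius r c) (stereo u) =
    (cos r <= dotprod u c) :> Prop.
  by rewrite -(spherical_diskE r0 hu hc); split=> [[]|].
move: hu hc zu zc; rewrite /sphere2 /= /disk /sqnorm.
rewrite /stereo /stereo_center /stereo_radius !dotprod3E.
move: (cos r) (sin r) cs => C S cs.
rewrite ![((_ - _) : 'rV[R]_2) _ _]mxE ![(- _ : 'rV[R]_2) _ _]mxE !vec2E.
set a := u 0 0; set b := u 0 1; set z := u 0 2%:R => u1.
set a' := c 0 0; set b' := c 0 1; set z' := c 0 2%:R => c1 z1 zC.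
have zn : 1 - z != 0 by rewrite gt_eqF //; lra.
have zn' : C - z' != 0 by rewrite gt_eqF //; lra.
rewrite -subr_le0 -[X in _ = is_true X]subr_le0.
have -> : (a / (1 - z) - a' / (C - z')) ^+ 2 + (b / (1 - z) - b' / (C - z')) ^+ 2 -
   (S / (C - z')) ^+ 2 = (C - (a * a' + b * b' + z * z')) * (2 / ((1 - z) * (C - z'))).
  have -> : (a / (1 - z) - a' / (C - z')) ^+ 2 + (b / (1 - z) - b' / (C - z')) ^+ 2 -
    (S / (C - z')) ^+ 2 = (a * a + b * b) / (1 - z) ^+ 2
    - 2 * (a * a' + b * b') / ((1 - z) * (C - z')) + (a' * a' + b' * b' - S ^+ 2) / (C - z') ^+ 2.
    by field; rewrite zn zn'.
  have -> : a * a + b * b = 1 - z * z by lra.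
  have -> : a' * a' + b' * b' - S ^+ 2 = C ^+ 2 - z' * z' by lra.
  by field; rewrite zn zn'.
by rewrite pmulr_lle0 // divr_gt0 // mulr_gt0 //; lra.
Qed.

Lemma stereo_onto p : exists u, [/\ sphere2 u, u 0 2%:R < 1 & stereo u = p].
Proof.
set q := sqnorm p; have q0 : 0 <= q by rewrite addr_ge0 ?sqr_ge0.
have q1 : q + 1 != 0 by rewrite gt_eqF //; lra.
exists (vec3 (2 * p 0 0 / (q + 1)) (2 * p 0 1 / (q + 1)) ((q - 1) / (q + 1))).
rewrite /sphere2 /= dotprod3E /stereo !vec3E; split.
- have -> : 2 * p 0 0 / (q + 1) * (2 * p 0 0 / (q + 1)) +
    2 * p 0 1 / (q + 1) * (2 * p 0 1 / (q + 1)) + (q - 1) / (q + 1) * ((q - 1) / (q + 1)) =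
    ((q - 1) ^+ 2 + 4 * (p 0 0 ^+ 2 + p 0 1 ^+ 2)) / (q + 1) ^+ 2 by field.
  by rewrite -/(sqnorm p) -/q; field.
- by rewrite ltr_pdivrMr; lra.
- have d2 : 1 - (q - 1) / (q + 1) = 2 / (q + 1) by field.
  by apply: rV2P; rewrite !vec2E d2; field.
Qed.

(** A point of height at least 1 is the pole itself; hence all points of a disk avoiding the pole
    can be projected. *)
Lemma sphere_pole u v : sphere2 u -> 1 <= u 0 2%:R -> dotprod u v = v 0 2%:R.
Proof.
rewrite /sphere2 /= !dotprod3E.
set a := u 0 0; set b := u 0 1; set z := u 0 2%:R => u1 z1.
have z2 : 1 <= z * z by rewrite -[leLHS]mulr1 ler_pM.
have a0 : a = 0.
  by apply/eqP; rewrite -sqrf_eq0 eq_le sqr_ge0 andbT; have := sqr_ge0 b; lra.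
have b0 : b = 0.
  by apply/eqP; rewrite -sqrf_eq0 eq_le sqr_ge0 andbT; have := sqr_ge0 a; lra.
have zE : z = 1.
  have := sqr_ge0 a; have := sqr_ge0 b => ? ?.
  by apply/eqP; rewrite eq_le z1 andbT -(@expr_le1 _ 2) // ?expr2; lra.
by rewrite a0 b0 zE; ring.
Qed.

Lemma spherical_disk_graph_separator r (G : sgraph) : 0 < r < pi ->
  is_spherical_disk_graph r G ->
  has_clique_based_separator G (25 / 26 : R) (528 * Num.sqrt #|G|%:R).
Proof.
move=> r0 [c [hc edgeE]]; pose pole : 'rV[R]_3 := vec3 0 0 1.
have hpole : sphere2 pole by rewrite /sphere2 /= dotprod3E !vec3E; ring.
have poleE x : dotprod pole (c x) = c x 0 2%:R by rewrite dotprod3E !vec3E; ring.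
pose Q := [set x : G | c x 0 2%:R < cos r]%SET.
apply: (@disk_graph_separator R G Q (fun x => stereo_center r (c x))
  (fun x => stereo_radius r (c x))).
- move=> x; rewrite inE => xQ; rewrite divr_ge0 ?subr_ge0 ?(ltW xQ) //.
  by case/andP: r0 => r0 rpi; rewrite sin_ge0_pi // !ltW.
- move=> x y; rewrite !inE -!leNgt => xQ yQ xy; apply/edgeE; split=> //.
  by exists pole; split; split; rewrite //= spherical_diskE // poleE.
- have zlt x u : x \in Q -> spherical_disk r (c x) u -> u 0 2%:R < 1.
    rewrite inE => xQ [hu]; rewrite spherical_diskE // => ux.
    by rewrite ltNge; apply: contraTN ux => /(sphere_pole _ hu) ->; rewrite -ltNge.
  move=> x y xQ yQ; have := xQ; have := yQ; rewrite !inE => yC xC.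
  split=> [/edgeE[xy [u [ux uy]]]|[xy [p [px py]]]].
    have hu : sphere2 u by case: ux.
    have u1 := zlt x u xQ ux.
    by split=> //; exists (stereo u); split; apply/stereo_disk.
  have [u [hu u1 uE]] := stereo_onto p.
  apply/edgeE; split=> //; exists u.
  by split; apply/stereo_disk => //; rewrite uE.
Qed.

End Spherical.

Lemma has_clique_based_separator_mono (R : realType) (G : sgraph) (beta beta' s s' : R) :
  beta <= beta' -> s <= s' ->
  has_clique_based_separator G beta s -> has_clique_based_separator G beta' s'.
Proof.
move=> bb ss [S [[Sc St [A [B [[AB cAB] SAB]]]] cS]]; exists S; split.
  split=> //; exists A, B; split=> //; split=> //.
  by apply: le_trans cAB _; rewrite ler_wpM2r.
exact: le_trans ss.
Qed.

Theorem corollary5p3 (R : realType) :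
  exists2 beta : R, beta < 1 &
  [/\ exists C : R, forall G : sgraph, is_0map_graph R G ->
        has_clique_based_separator G beta (C * Num.sqrt #|G|%:R),
      exists C : R, forall G : sgraph, is_unit_disk_graph R G ->
        has_clique_based_separator G beta (C * Num.sqrt #|G|%:R),
      exists C : R, forall (r : R) (G : sgraph), 0 < r ->
        is_hyperbolic_disk_graph r G ->
        has_clique_based_separator G beta
          (C * (Num.sqrt (r / tanh r) * Num.sqrt #|G|%:R))
    & exists C : R, forall (r : R) (G : sgraph), 0 < r < pi ->
        is_spherical_disk_graph r G ->
        has_clique_based_separator G beta (C * Num.sqrt #|G|%:R)].
Proof.
exists (25 / 26); first lra.
split.
- exists 170 => G /map_graph_separator; apply: has_clique_based_separator_mono => //; lra.
- by exists 528 => G; apply: unit_disk_graph_separator.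
(* Twice [528], to absorb the lower bound [1 / 2] of the factor depending on [r]. *)
- exists 1056 => r G r0 /(hyperbolic_disk_graph_separator r0).
  apply: has_clique_based_separator_mono => //.
  rewrite mulrA ler_wpM2r ?sqrtr_ge0 //; have := tanh_factor_ge r0; lra.
- by exists 528 => r G; apply: spherical_disk_graph_separator.
Qed.
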